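(* Let $\kappa$ be a cardinal and let $X=c_0(\kappa)$ or $X=\ell_p(\kappa)$ with $1<p<\infty$. (1) If $\kappa<\mathrm{cov}(\mathcal M)$, then $X$ has the weak Lebesgue property. (2) If $\kappa\ge \mathrm{non}(\mathcal{SN})$, then $X$ does not have the weak Lebesgue property.
   Context: All Banach spaces are real. A tagged partition of $[0,1]$ is a finite collection $\mathcal P=\{(s_i,[t_{i-1},t_i]):1\le i\le N\}$, where the $[t_{i-1},t_i]$ are non-overlapping closed intervals covering $[0,1]$ and $s_i\in(t_{i-1},t_i)$; its norm is $\max_i(t_i-t_{i-1})$, and for $f:[0,1]\to X$ one puts $f(\mathcal P)=\sum_{i=1}^N (t_i-t_{i-1})f(s_i)$. A function $f:[0,1]\to X$ into a Banach space $X$ is Riemann integrable, with integral $x\in X$, if for every $\varepsilon>0$ there is $\delta>0$ such that $\|f(\mathcal P)-x\|<\varepsilon$ for all tagged partitions $\mathcal P$ of $[0,1]$ with norm less than $\delta$. A Banach space $X$ has the weak Lebesgue property (WLP) if every Riemann integrable $f:[0,1]\to X$ is weakly continuous almost everywhere, i.e. the set of points of $[0,1]$ at which $f$ is not continuous with respect to the weak topology of $X$ has Lebesgue measure zero. $\mathrm{cov}(\mathcal M)$ is the smallest cardinality of a family of nowhere dense subsets of $[0,1]$ whose union is $[0,1]$. A set $A\subset\mathbb R$ is strongly null if for every sequence $(\varepsilon_n)_{n=1}^\infty$ of positive reals there is a sequence of intervals $(I_n)_{n=1}^\infty$ with the length of $I_n$ less than $\varepsilon_n$ for every $n$ and $A\subset\bigcup_n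 I_n$. $\mathrm{non}(\mathcal{SN})$ is the smallest cardinality of a subset of $\mathbb R$ that is not strongly null. *)

(* Defs.v *)
From HB Require Import structures.
From mathcomp Require Import all_boot all_order all_algebra finmap.
From mathcomp Require Import all_classical all_reals all_analysis.
From mathcomp Require Import ring lra.

Set Implicit Arguments.
Unset Strict Implicit.
Unset Printing Implicit Defensive.

Import Order.TTheory GRing.Theory Num.Theory.
Import numFieldNormedType.Exports.

Local Open Scope classical_set_scope.
Local Open Scope ring_scope.

Definition unit_itv (R : realType) : set R := `[0, 1]%classic.
Arguments unit_itv R : clear implicits.

(* The non-overlapping intervals are listed in increasing order; the values of
   tp_node and tp_tag beyond tp_size are irrelevant. *)
Record tagged_partition (R : realType) := TaggedPartition {
  tp_size : nat;
  tp_node : nat -> R;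
  tp_tag : nat -> R;
  tp_node0 : tp_node 0%N = 0;
  tp_node_size : tp_node tp_size = 1;
  tp_tag_in : forall i, (i < tp_size)%N ->
    tp_node i < tp_tag i < tp_node i.+1
}.

Definition tp_norm (R : realType) (P : tagged_partition R) : R :=
  \big[Num.max/0]_(i < tp_size P) (tp_node P i.+1 - tp_node P i).

(* A function on [0,1] is represented by a total function on R; only its
   restriction to [0,1] is used. *)
Definition riemann_sum (R : realType) (X : normedModType R) (f : R -> X)
    (P : tagged_partition R) : X :=
  \sum_(i < tp_size P) (tp_node P i.+1 - tp_node P i) *: f (tp_tag P i).

Definition riemann_integrable (R : realType) (X : normedModType R)
    (f : R -> X) : Prop :=
  exists x : X, forall e : R, 0 < e -> exists2 d : R, 0 < d &
    forall P : tagged_partition R, tp_norm P < d ->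
      `|riemann_sum f P - x| < e.

Definition dual (R : realType) (X : normedModType R) : Type :=
  {phi : {linear X -> R^o} | continuous phi}.

(* X with its weak topology: the coarsest topology making all the continuous
   linear functionals on X continuous. *)
Definition weak (R : realType) (X : normedModType R) : topologicalType :=
  sup_topology (fun phi : dual X =>
    Topological.class (initial_topology (sval phi : X -> R^o))).

(* Continuity at t is relative to [0,1], so it is one-sided at 0 and 1. *)
Definition weakly_continuous_at (R : realType) (X : normedModType R)
    (f : R -> X) (t : R) : Prop :=
  {for t, continuous (f : subspace (unit_itv R) -> weak X)}.

Definition weak_lebesgue_property (R : realType)
    (X : completeNormedModType R) : Prop :=
  forall f : R -> X, riemann_integrable f ->
    (@lebesgue_measure R).-negligible
      [set t | unit_itv R t /\ ~ weakly_continuous_at f t].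

Definition card_lt (T U : Type) (A : set T) (B : set U) : bool :=
  (A #<= B)%card && ~~ (B #<= A)%card.

(* A set of smallest cardinality among those satisfying P (see least_cardP);
   it represents the cardinal min {|A| : P A}. *)
Definition least_card (T : Type) (P : set (set T)) : set T :=
  xget set0 [set A | P A /\ forall B, P B -> (A #<= B)%card].

Lemma least_card_exists (T : Type) (P : set (set T)) : P !=set0 ->
  exists A, P A /\ forall B, P B -> (A #<= B)%card.
Proof.
move=> [A0 PA0].
pose I := {A : set T | P A}.
(* Q: the sets of choice functions that are pairwise distinct at every
   coordinate; a maximal one surjects onto some coordinate and injects into
   all of them *)
pose F := {f : I -> T | forall i, sval i (f i)}.
pose Q := [set S : set F | forall f g, S f -> S g ->
   (exists i, sval f i = sval g i) -> f = g].
have [|S [QS maxS]] := @Zorn_bigcup F Q.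
  move=> G GQ Gtot f g [S1 GS1 S1f] [S2 GS2 S2g] fg.
  have [S12|S21] := Gtot _ _ GS1 GS2.
    by apply: (GQ _ GS2) => //; exact: S12.
  by apply: (GQ _ GS1) => //; exact: S21.
have [i Si] : exists i : I, forall x, sval i x -> exists2 f, S f & sval f i = x.
  apply: contrapT => /forallNP H.
  have H' (i : I) : exists x, sval i x /\ forall f, S f -> sval f i <> x.
    have /existsNP[x] := H i => /not_implyP[ix nx]; exists x; split=> // f Sf fx.
    by apply: nx; exists f.
  have /choice[h hP] := H'.
  pose h0 : F := exist _ h (fun i => (hP i).1).
  have nSh : ~ S h0.
    by move=> Sh; exact: ((hP (exist _ A0 PA0)).2 _ Sh).
  apply: (maxS (S `|` [set h0])).
    by split=> [f Sf|SS]; [left|apply: nSh; apply: SS; right].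
  move=> f g [Sf|->] [Sg|->] [j fg] //.
  - by apply: QS => //; exists j.
  - by have := (hP j).2 _ Sf fg.
  - by have := (hP j).2 _ Sg (esym fg).
exists (sval i); split; first exact: (svalP i).
move=> B PB; pose j : I := exist _ B PB.
apply: card_le_trans (_ : (S #<= B)%card).
  rewrite (_ : sval i = [set sval f i | f in S]); first exact: card_image_le.
  apply/seteqP; split=> [x /Si[f Sf <-]|_ [f Sf <-]]; first by exists f.
  exact: svalP f i.
rewrite -(card_le_eql (inj_card_eq (f := fun f : F => sval f j) _)).
  apply: subset_card_le => _ [f Sf <-]; exact: (svalP f j).
by move=> f g /set_mem Sf /set_mem Sg fg; apply: QS => //; exists j.
Qed.

Lemma least_cardP (T : Type) (P : set (set T)) : P !=set0 ->
  P (least_card P) /\ forall B, P B -> (least_card P #<= B)%card.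
Proof.
move=> /least_card_exists[A PA].
exact: (@xgetPex _ set0 [set A | P A /\ forall B, P B -> (A #<= B)%card]
  (ex_intro _ A PA)).
Qed.

Definition nowhere_dense (T : topologicalType) (A : set T) : Prop :=
  (closure A)^° = set0.

(* Closure and interior are taken in the space [0,1]. *)
Definition nowhere_dense_cover (R : realType) (F : set (set R)) : Prop :=
  (forall A, F A -> A `<=` unit_itv R /\
     nowhere_dense (A : set (subspace (unit_itv R)))) /\
  \bigcup_(A in F) A = unit_itv R.
Arguments nowhere_dense_cover R F : clear implicits.

(* cov(M), as a cover of that cardinality. *)
Definition covM (R : realType) : set (set R) :=
  least_card (nowhere_dense_cover R).
Arguments covM R : clear implicits.

Definition strongly_null (R : realType) (A : set R) : Prop :=
  forall e : nat -> R, (forall n, 0 < e n) ->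
  exists I : nat -> interval R,
    (forall n, lebesgue_measure [set` I n] < (e n)%:E)%E /\
    A `<=` \bigcup_n [set` I n].

(* non(SN), as a set of that cardinality. *)
Definition nonSN (R : realType) : set R :=
  least_card [set A : set R | ~ strongly_null A].
Arguments nonSN R : clear implicits.

Lemma covMP (R : realType) : nowhere_dense_cover R (covM R) /\
  forall F, nowhere_dense_cover R F -> (covM R #<= F)%card.
Proof.
apply: least_cardP; exists [set [set x] | x in unit_itv R]; split; last first.
  apply/seteqP; split=> [_ [_ [x Ix <-] ->]//|x Ix].
  by exists [set x] => //; exists x.
move=> _ [x Ix <-]; split=> [_ -> //|].
rewrite /nowhere_dense.
have -> : closure ([set x] : set (subspace (unit_itv R))) = [set x].
  apply/esym/closure_id; apply: (@closed_subspaceW R (unit_itv R) [set x]).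
  exact: (@accessible_closed_set1 R (hausdorff_accessible (@Rhausdorff R))).
rewrite -subset0 => y xy; have yx := interior_subset xy; rewrite yx in xy.
have {xy} : within (unit_itv R) (nbhs x) [set x].
  by rewrite (nbhs_subspace_in Ix); exact: xy.
move=> /nbhs_ballP[e /= e0 xe].
move: Ix; rewrite /unit_itv /= in_itv /= => /andP[x0 x1].
pose d := Num.min e 1 / 2.
have d0 : 0 < d by rewrite /d divr_gt0// lt_min e0 ltr01.
have de : d < e.
  have le1 : Num.min e 1 <= e by rewrite ge_min lexx.
  by rewrite /d; lra.
have d1 : d <= 2^-1.
  have le1 : Num.min e 1 <= 1 by rewrite ge_min lexx orbT.
  by rewrite /d; lra.
have [x2|x2] := leP x 2^-1.
  have Id : unit_itv R (x + d).
    by rewrite /unit_itv /= in_itv /=; apply/andP; split; lra.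
  have Bd : ball x e (x + d).
    by rewrite /ball /= opprD addNKr normrN gtr0_norm.
  by have /= := xe _ Bd Id; lra.
have Id : unit_itv R (x - d).
  by rewrite /unit_itv /= in_itv /=; apply/andP; split; lra.
have Bd : ball x e (x - d).
  by rewrite /ball /= opprB addrC subrK gtr0_norm.
by have /= := xe _ Bd Id; lra.
Qed.

Lemma nonSNP (R : realType) : ~ strongly_null (nonSN R) /\
  forall A : set R, ~ strongly_null A -> (nonSN R #<= A)%card.
Proof.
apply: (@least_cardP _ [set A : set R | ~ strongly_null A]).
exists setT => /= SN.
have e0 n : 0 < 1 / (2 ^ n.+1)%:R :> R.
  by rewrite divr_gt0// ltr0n expn_gt0.
have [I [Ie cI]] := SN (fun n => 1 / (2 ^ n.+1)%:R) e0.
have := @measure_sigma_subadditive _ _ _ (@lebesgue_measure R) setT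
  (fun n => [set` I n]) (fun n => measurable_itv (I n)) measurableT cI.
have -> : [set: R] = [set` `]-oo, +oo[%R] by apply/esym; rewrite set_itvE.
rewrite [X in (X <= _)%E -> _](_ : _ = +oo%E); last first.
  exact: lebesgue_measure_itv.
move=> /le_trans-/(_ 1%:E) H.
have /H : (\sum_(n <oo) lebesgue_measure [set` I n] <= 1%:E)%E.
  apply: le_trans (epsilon_trick0 xpredT ler01).
  by apply: lee_nneseries => // n _; exact: ltW.
by rewrite leNgt ltry.
Qed.

Section complete_from_coordinates.
Variables (R : realType) (K : Type) (V : normedModType R) (ev : V -> K -> R).
Hypothesis ev_le : forall x y k, `|ev x k - ev y k| <= `|x - y|.
Hypothesis ev_dom : forall (F : set_system V) (g : K -> R), ProperFilter F ->
  (forall k, (fun x => ev x k) @ F --> g k) ->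
  (forall e : R, 0 < e -> exists x, F [set y | `|y - x| <= e]) ->
  exists z, ev z = g.
Hypothesis ev_lim : forall (F : set_system V) x z (e : R), ProperFilter F ->
  (forall k, (fun x => ev x k) @ F --> ev z k) -> 0 < e ->
  F [set y | `|y - x| <= e] -> `|z - x| <= e.

Lemma complete_from_coordinates (F : set_system V) :
  ProperFilter F -> cauchy F -> cvg F.
Proof.
move=> FF /cauchyP Fc.
have Fc' (e : R) : 0 < e -> exists x, F [set y | `|y - x| <= e].
  move=> e0; have [x Fx] := Fc _ e0; exists x; apply: filterS Fx => y.
  by rewrite -ball_normE /= distrC => /ltW.
have cvgk k : cvg ((fun x => ev x k) @ F).
  apply: cauchy_cvg; apply/cauchyP => e e0.
  have e2 : 0 < e / 2 by rewrite divr_gt0.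
  have [x Fx] := Fc' _ e2; exists (ev x k).
  rewrite /fmap /=; apply: (@filterS _ F _ [set y | `|y - x| <= e / 2]) => //.
  move=> y /= yx.
  by have := ev_le y x k; rewrite /ball /= distrC; lra.
have [z zg] := @ev_dom F (fun k => lim ((fun x => ev x k) @ F)) FF cvgk Fc'.
apply/cvg_ex; exists z; apply/cvgrPdist_le => e e0.
have e2 : 0 < e / 2 by rewrite divr_gt0.
have [x Fx] := Fc' _ e2.
have zx : `|z - x| <= e / 2.
  apply: (@ev_lim F) => // k; rewrite zg; exact: cvgk.
apply: filterS Fx => y /= yx.
by rewrite (le_trans (ler_distD x _ _))// [X in _ + X]distrC; lra.
Qed.

End complete_from_coordinates.

Section c0_space.
Variables (R : realType) (K : choiceType).

(* f tends to 0 along the cofinite filter of K *)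
Definition c0_pred : {pred K -> R^o} := fun f =>
  `[< forall e : R, 0 < e -> finite_set [set k | e <= `|f k|] >].

Lemma c0_submod_closed : submod_closed c0_pred.
Proof.
split.
  apply/asboolP => e e0; rewrite (_ : mkset _ = set0) //.
  by apply/seteqP; split => // k /=; rewrite normr0; lra.
move=> a f g /asboolP fP /asboolP gP; apply/asboolP => e e0.
have e2 : 0 < e / 2 by rewrite divr_gt0.
have ea : 0 < e / 2 / (`|a| + 1) by rewrite divr_gt0// ltr_wpDl.
apply: (@sub_finite_set _ _ ([set k | e / 2 / (`|a| + 1) <= `|f k|] `|`
   [set k | e / 2 <= `|g k|])); last first.
  by rewrite finite_setU; split; [exact: fP|exact: gP].
move=> k /= ek; apply: contrapT => /not_orP[/negP + /negP].
rewrite -!ltNge ltr_pdivlMr ?ltr_wpDl// => fk gk.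
move: ek; apply/negP; rewrite -ltNge.
rewrite (le_lt_trans (ler_normD _ _))// normrM.
have := normr_ge0 (f k); have := normr_ge0 a; nra.
Qed.

HB.instance Definition _ := GRing.isSubmodClosed.Build R (K -> R^o) c0_pred
  c0_submod_closed.

Record c0 : Type := C0 { c0_val :> K -> R^o; _ : c0_val \in c0_pred }.

HB.instance Definition _ := [isSub of c0 for c0_val].
HB.instance Definition _ := [Choice of c0 by <:].
HB.instance Definition _ := [SubChoice_isSubLmodule of c0 by <:].

Definition c0_norm (f : c0) : R := sup [set `|f k| | k in [set: K]].

Lemma c0_has_sup (f : c0) : has_ubound [set `|f k| | k in [set: K]].
Proof.
case: f => f fP; move: (fP) => /asboolP /(_ 1 ltr01) fin1 /=.
exists (1 + \sum_(k <- fset_set [set k | 1 <= `|f k|]) `|f k|) => _ [k _ <-].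
have [k1|k1] := leP 1 `|f k|; last first.
  by apply: ler_wpDr (ltW k1); exact: sumr_ge0.
apply: ler_wpDl => //.
rewrite (big_fsetD1 k) ?in_fset_set ?inE//= lerDl.
by apply: sumr_ge0.
Qed.

Lemma c0_norm_ge (f : c0) k : `|f k| <= c0_norm f.
Proof. by apply: ub_le_sup; [exact: c0_has_sup|exists k]. Qed.

Lemma c0_norm_ge0 (f : c0) : 0 <= c0_norm f.
Proof.
have [[k]|nK] := pselect (exists k : K, True).
  by move=> _; exact: le_trans (c0_norm_ge f k).
rewrite /c0_norm (_ : [set _ | _ in _] = set0) ?sup0//.
by rewrite -subset0 => x [k _ _]; apply: nK; exists k.
Qed.

Lemma c0_norm_le (f : c0) c : 0 <= c -> (forall k, `|f k| <= c) ->
  c0_norm f <= c.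
Proof.
move=> c0 fc.
have [[k]|nK] := pselect (exists k : K, True).
  move=> _; apply: ge_sup; first by exists `|f k|, k.
  by move=> _ [k' _ <-].
rewrite /c0_norm (_ : [set _ | _ in _] = set0) ?sup0//.
by rewrite -subset0 => x [k _ _]; apply: nK; exists k.
Qed.

Lemma c0_normD f g : c0_norm (f + g) <= c0_norm f + c0_norm g.
Proof.
apply: c0_norm_le => [|k]; first by rewrite addr_ge0// c0_norm_ge0.
by rewrite (le_trans (ler_normD _ _))// lerD// c0_norm_ge.
Qed.

Lemma c0_normZ (l : R) f : c0_norm (l *: f) = `|l| * c0_norm f.
Proof.
have le (a : R) g : c0_norm (a *: g) <= `|a| * c0_norm g.
  apply: c0_norm_le => [|k]; first by rewrite mulr_ge0// c0_norm_ge0.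
  by rewrite [X in `|X|](_ : _ = a * g k)// normrM ler_wpM2l// c0_norm_ge.
apply/eqP; rewrite eq_le le /=.
have [->|l0] := eqVneq l 0; first by rewrite normr0 mul0r c0_norm_ge0.
rewrite -ler_pdivlMl ?normr_gt0// -normfV.
by rewrite -[X in c0_norm X <= _](scalerK l0) le.
Qed.

Lemma c0_norm0_eq0 f : c0_norm f = 0 -> f = 0.
Proof.
move=> f0; apply/val_inj/funext => k /=.
by apply/eqP; rewrite -normr_le0 -f0 c0_norm_ge.
Qed.

HB.instance Definition _ := Lmodule_isNormed.Build R c0
  c0_normD c0_normZ c0_norm0_eq0.

Lemma c0_complete (F : set_system c0) : ProperFilter F -> cauchy F -> cvg F.
Proof.
apply: (@complete_from_coordinates _ K _ (fun f : c0 => f : K -> R)).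
- by move=> x y k; exact: (c0_norm_ge (x - y)).
- move=> {}F g FF Fg Fx.
  suff gP : (g : K -> R^o) \in c0_pred by exists (C0 gP).
  apply/asboolP => e e0.
  have e2 : 0 < e / 2 by rewrite divr_gt0.
  have e4 : 0 < e / 4 by rewrite divr_gt0.
  have [x {}Fx] := Fx _ e4.
  have := valP x; move=> /asboolP/(_ _ e2); apply: sub_finite_set => k /= ek.
  have /cvgrPdist_lt/(_ _ e4) gk := Fg k.
  have [y [/= yx gy]] := filter_ex (filterI Fx gk).
  have := le_trans (c0_norm_ge (y - x) k) yx.
  rewrite [X in `|X|](_ : _ = y k - x k)// => yxk.
  have := ler_distD (y k) (g k) (x k); have := ler_distD (x k) (g k) 0.
  by rewrite !subr0; lra.
- move=> {}F x z e FF Fz e0 Fx; apply: c0_norm_le => [|k]; first exact: ltW.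
  rewrite [X in `|X|](_ : _ = z k - x k)//.
  apply/ler_addgt0Pr => d d0; have /cvgrPdist_lt/(_ _ d0) gk := Fz k.
  have [y [/= yx gy]] := filter_ex (filterI Fx gk).
  have := le_trans (c0_norm_ge (y - x) k) yx.
  rewrite [X in `|X|](_ : _ = y k - x k)// => yxk.
  by have := ler_distD (y k) (z k) (x k); lra.
Qed.

HB.instance Definition _ := Uniform_isComplete.Build c0 c0_complete.

End c0_space.
Arguments c0 R K : clear implicits.

Section lp_space.
Variables (R : realType) (K : choiceType) (p : R).
Hypothesis p1 : 1 <= p.

Let p0 : 0 < p. Proof. exact: lt_le_trans p1. Qed.

Definition lp_sum (f : K -> R^o) : \bar R :=
  (\esum_(k in [set: K]) (`|f k| `^ p)%:E)%E.

(* The unused argument makes the type lp below depend on the proof of 1 <= p,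
   so that its normed space structure can be inferred. *)
Definition lp_pred_of (_ : 1 <= p) : {pred K -> R^o} :=
  fun f => (lp_sum f < +oo)%E.
Local Notation lp_pred := (lp_pred_of p1).

Let N (f : K -> R^o) : R := fine (lp_sum f) `^ p^-1.

Let powN (f : K -> R^o) : N f `^ p = fine (lp_sum f).
Proof.
rewrite /N -powRrM mulVf ?gt_eqF// powRr1// fine_ge0//.
by apply: esum_ge0 => k _; rewrite lee_fin powR_ge0.
Qed.

Let fsum (A : {fset K}) (f : K -> R^o) : R := \sum_(k <- A) `|f k| `^ p.

Let fsum_le (f : K -> R^o) (A : {fset K}) : f \in lp_pred ->
  fsum A f <= N f `^ p.
Proof.
rewrite unfold_in => fp; rewrite powN -lee_fin fineK; last first.
  rewrite ge0_fin_numE//.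
  by apply: esum_ge0 => k _; rewrite lee_fin powR_ge0.
apply: esum_ge; exists [set` A].
  by split => //; exact: finite_fset.
rewrite fsbig_finite; last exact: finite_fset.
by rewrite set_fsetK /fsum -sumEFin.
Qed.

Let le_fsum (f : K -> R^o) c : 0 <= c ->
  (forall A, fsum A f <= c `^ p) -> f \in lp_pred /\ N f <= c.
Proof.
move=> c0 fc.
have fcp : (lp_sum f <= (c `^ p)%:E)%E.
  apply: ge_ereal_sup => _ [X [finX _] <-].
  by rewrite fsbig_finite// sumEFin lee_fin; exact: fc.
have fp : f \in lp_pred.
  by rewrite unfold_in (le_lt_trans fcp)// ltry.
split => //.
have : N f `^ p <= c `^ p.
  rewrite powN -lee_fin fineK// ge0_fin_numE//.
  by apply: esum_ge0 => k _; rewrite lee_fin powR_ge0.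
apply: contraTT; rewrite -!ltNge => cN.
by apply: gt0_ltr_powR => //; rewrite nnegrE// powR_ge0.
Qed.

Let fsum_minkowski (A : {fset K}) (f g : K -> R^o) a b : 0 < a -> 0 < b ->
  fsum A f <= a `^ p -> fsum A g <= b `^ p -> fsum A (f + g) <= (a + b) `^ p.
Proof.
move=> a0 b0 fa gb.
have ab : 0 < a + b by rewrite addr_gt0.
have nz x : 0 < x -> x `^ p != 0 by move=> x0; rewrite gt_eqF// powR_gt0.
pose t := a / (a + b).
have t01 : 0 <= t <= 1.
  rewrite /t; apply/andP; split; first by rewrite divr_ge0// ltW.
  by rewrite ler_pdivrMr// mul1r lerDl ltW.
have tb : 1 - t = b / (a + b).
  by rewrite /t; field; rewrite gt_eqF.
have pt k : `|(f + g) k| `^ p <= (a + b) `^ p *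
    (t * (`|f k| `^ p / a `^ p) + (1 - t) * (`|g k| `^ p / b `^ p)).
  apply: (@le_trans _ _ ((`|f k| + `|g k|) `^ p)).
    by apply: ge0_ler_powR; rewrite ?nnegrE ?addr_ge0 ?ler_normD// ltW.
  have -> : `|f k| + `|g k| =
      (a + b) * (t * (`|f k| / a) + (1 - t) * (`|g k| / b)).
    by rewrite tb /t; field; rewrite !gt_eqF.
  have fa0 : 0 <= `|f k| / a by rewrite divr_ge0// ltW.
  have gb0 : 0 <= `|g k| / b by rewrite divr_ge0// ltW.
  rewrite powRM ?(ltW ab)//; last first.
    by move/andP : t01 => [? ?]; rewrite addr_ge0// mulr_ge0// subr_ge0.
  rewrite ler_wpM2l ?powR_ge0//.
  have E x y : 0 <= x -> 0 < y -> x `^ p / y `^ p = (x / y) `^ p.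
    move=> x0 y0; rewrite powRM ?invr_ge0 ?(ltW y0)//; congr (_ * _).
    by rewrite -[y^-1]powR_inv1 ?ltW// -powRrM mulN1r powRN.
  rewrite !E//.
  have [t0' t1'] := andP t01.
  have := @convex_powR R p p1 (Itv01 t0' t1') (`|f k| / a) (`|g k| / b).
  by rewrite !inE /= !in_itv /= !andbT => /(_ fa0 gb0); rewrite !convRE.
have [t0 t1] := andP t01.
apply: (@le_trans _ _ (\sum_(k <- A) (a + b) `^ p *
    (t * (`|f k| `^ p / a `^ p) + (1 - t) * (`|g k| `^ p / b `^ p)))).
  by apply: ler_sum => k _; exact: pt.
rewrite -mulr_sumr -[leRHS]mulr1 ler_wpM2l ?powR_ge0//.
rewrite big_split /= -!mulr_sumr -!mulr_suml.
have fa' : fsum A f / a `^ p <= 1 by rewrite ler_pdivrMr ?powR_gt0// mul1r.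
have gb' : fsum A g / b `^ p <= 1 by rewrite ler_pdivrMr ?powR_gt0// mul1r.
have t1' : 0 <= 1 - t by rewrite subr_ge0.
have := ler_wpM2l t0 fa'; have := ler_wpM2l t1' gb'.
rewrite /fsum; lra.
Qed.

Let N_ge0 f : 0 <= N f. Proof. exact: powR_ge0. Qed.

Let pow_mono x y : 0 <= x -> x <= y -> x `^ p <= y `^ p.
Proof.
move=> x0 xy; apply: ge0_ler_powR; rewrite ?nnegrE ?(le_trans x0 xy)//.
exact: ltW.
Qed.

Let minkowski_lp f g : f \in lp_pred -> g \in lp_pred ->
  f + g \in lp_pred /\ N (f + g) <= N f + N g.
Proof.
move=> fp gp.
have H e : 0 < e -> f + g \in lp_pred /\ N (f + g) <= N f + N g + e.
  move=> e0; apply: le_fsum => [|A]; first by rewrite addr_ge0 ?(ltW e0)// addr_ge0.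
  have -> : N f + N g + e = (N f + e / 2) + (N g + e / 2).
    by rewrite addrACA -splitr.
  have e2 : 0 < e / 2 by rewrite divr_gt0.
  apply: fsum_minkowski; rewrite ?ltr_wpDl//.
    by apply: le_trans (fsum_le _ fp) _; apply: pow_mono; rewrite ?lerDl// ltW.
  by apply: le_trans (fsum_le _ gp) _; apply: pow_mono; rewrite ?lerDl// ltW.
split; first by have [] := H 1 ltr01.
by apply/ler_addgt0Pr => e /H[].
Qed.

Let scale_lp (l : R) f : f \in lp_pred ->
  l *: f \in lp_pred /\ N (l *: f) <= `|l| * N f.
Proof.
move=> fp; apply: le_fsum => [|A]; first by rewrite mulr_ge0.
rewrite powRM// (le_trans _ (ler_wpM2l (powR_ge0 _ _) (fsum_le A fp)))//.
rewrite /fsum mulr_sumr; apply: ler_sum => k _.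
by rewrite [X in `|X|](_ : _ = l * f k)// normrM powRM.
Qed.

Lemma lp_submod_closed : submod_closed lp_pred.
Proof.
split.
  suff [] : (0 : K -> R^o) \in lp_pred /\ N (0 : K -> R^o) <= 0 by [].
  apply: le_fsum => // A; rewrite /fsum big1 ?powR_ge0// => k _.
  by rewrite normr0 powR0// gt_eqF.
by move=> a f g /(scale_lp a)[fp _] /(minkowski_lp fp)[].
Qed.

HB.instance Definition _ := GRing.isSubmodClosed.Build R (K -> R^o) lp_pred
  lp_submod_closed.

Record lp : Type := Lp { lp_val :> K -> R^o; _ : lp_val \in lp_pred }.

HB.instance Definition _ := [isSub of lp for lp_val].
HB.instance Definition _ := [Choice of lp by <:].
HB.instance Definition _ := [SubChoice_isSubLmodule of lp by <:].

Definition lp_norm (f : lp) : R := fine (lp_sum f) `^ p^-1.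

Lemma lp_normD f g : lp_norm (f + g) <= lp_norm f + lp_norm g.
Proof. exact: (minkowski_lp (valP f) (valP g)).2. Qed.

Lemma lp_normZ (l : R) f : lp_norm (l *: f) = `|l| * lp_norm f.
Proof.
have le (a : R) g : lp_norm (a *: g) <= `|a| * lp_norm g.
  exact: (scale_lp a (valP g)).2.
apply/eqP; rewrite eq_le le /=.
have [->|l0] := eqVneq l 0; first by rewrite normr0 mul0r N_ge0.
rewrite -ler_pdivlMl ?normr_gt0// -normfV.
by rewrite -[X in lp_norm X <= _](scalerK l0) le.
Qed.

Lemma lp_norm_ge (f : lp) k : `|f k| <= lp_norm f.
Proof.
have := fsum_le [fset k]%fset (valP f); rewrite /fsum big_seq_fset1.
apply: contraTT; rewrite -!ltNge => cN.
by apply: gt0_ltr_powR => //; rewrite nnegrE// N_ge0.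
Qed.

Lemma lp_norm0_eq0 f : lp_norm f = 0 -> f = 0.
Proof.
move=> f0; apply/val_inj/funext => k /=.
by apply/eqP; rewrite -normr_le0 -f0 lp_norm_ge.
Qed.

HB.instance Definition _ := Lmodule_isNormed.Build R lp
  lp_normD lp_normZ lp_norm0_eq0.

Let lp_fatou (F : set_system lp) (g : K -> R^o) (x : lp) e :
  ProperFilter F -> (forall k, (fun x : lp => (x : K -> R) k) @ F --> g k) ->
  0 < e -> F [set y | `|y - x| <= e] ->
  g - (x : K -> R^o) \in lp_pred /\ N (g - (x : K -> R^o)) <= e.
Proof.
move=> FF Fg e0 Fx.
have H d : 0 < d -> g - (x : K -> R^o) \in lp_pred /\
    N (g - (x : K -> R^o)) <= e + d.
  move=> d0; apply: le_fsum => [|A]; first by rewrite addr_ge0 ?ltW.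
  pose n := size A; pose h := d / n.+1%:R.
  have h0 : 0 < h by rewrite divr_gt0.
  have FA : F [set y : lp | forall k, k \in A -> `|g k - y k| <= h].
    apply: filterS (@filter_bigI _ _ A
      (fun k => [set y : lp | `|g k - y k| <= h]) F _ _).
      by move=> y yA k kA; exact: yA.
    by move=> k kA; have /cvgrPdist_le/(_ _ h0) := Fg k.
  have [y [/= yx gy]] := filter_ex (filterI Fx FA).
  have -> : g - (x : K -> R^o) = ((y - x : lp) : K -> R^o) + (g - (y : K -> R^o)).
    apply/funext => k; suff: g k - x k = (y k - x k) + (g k - y k) by [].
    by rewrite [RHS]addrC subrKA.
  apply: fsum_minkowski => //.
    by apply: le_trans (fsum_le _ (valP _)) _; apply: pow_mono.
  apply: (@le_trans _ _ (\sum_(k <- A) h `^ p)).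
    rewrite /fsum big_seq [leRHS]big_seq; apply: ler_sum => k kA.
    by apply: pow_mono => //; exact: gy.
  rewrite big_const_seq count_predT iter_addr_0 -[h `^ p *+ _]mulr_natl.
  have hd : d = n.+1%:R * h by rewrite /h mulrC divfK.
  clearbody h; rewrite hd.
  rewrite powRM ?(ltW h0)// ler_wpM2r ?powR_ge0//.
  apply: (@le_trans _ _ (n.+1%:R)); first by rewrite ler_nat.
  rewrite -[leLHS]powRr1//; apply: ler_powR => //.
  by rewrite ler1n.
split; first by have [] := H 1 ltr01.
by apply/ler_addgt0Pr => d /H[].
Qed.

Lemma lp_complete (F : set_system lp) : ProperFilter F -> cauchy F -> cvg F.
Proof.
apply: (@complete_from_coordinates _ K _ (fun f : lp => f : K -> R)).
- by move=> x y k; exact: (lp_norm_ge (x - y)).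
- move=> {}F g FF Fg Fx.
  suff gP : (g : K -> R^o) \in lp_pred by exists (Lp gP).
  have [x {}Fx] := Fx 1 ltr01.
  have [gx _] := lp_fatou FF Fg ltr01 Fx.
  by have [] := minkowski_lp gx (valP x); rewrite subrK.
- move=> {}F x z e FF Fz e0 Fx.
  by have [] := lp_fatou FF Fz e0 Fx.
Qed.

HB.instance Definition _ := Uniform_isComplete.Build lp lp_complete.

End lp_space.
Arguments lp {R} K {p} p1.

(* Main.v *)
Require Import Defs.
From HB Require Import structures.
From mathcomp Require Import all_boot all_order all_algebra finmap.
From mathcomp Require Import all_classical all_reals all_analysis.
From mathcomp Require Import ring lra zify.
From mathcomp Require Import measurable_realfun.
Import Order.TTheory GRing.Theory Num.Theory.
Import numFieldNormedType.Exports.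
Local Open Scope classical_set_scope.
Local Open Scope ring_scope.

Set Implicit Arguments.
Unset Strict Implicit.
Unset Printing Implicit Defensive.

(**
  Bounded nets in c0(K) and lp(K), 1 < p, converge weakly as soon as they
  converge coordinatewise.

  (1) Given eps, Riemann integrability yields partitions P_m such that, for
  every coordinate k at once, the cells of P_m on which f_k oscillates by more
  than eta have total length at most eps / 2^m. They form a point x_k of a
  product of finite sets, so if |K| < cov(M) a single g agrees with each x_k
  somewhere, and the cells listed by g cover all points at which some
  coordinate oscillates by more than eta.

  (2) Let A, contained in [z, z + 1[, fail to be strongly null, as witnessed by
  the sequence eps.
  Cut [z, z + 1[ into N_m equal pieces; reserve a block of N_m binary digits
  for each m and let a in A mark in the m-th block the digit whose rank is that
  of the piece containing a. Let D_a be the set of t all of whose digits marked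
  by a are 0. The D_a are closed up to dyadic points and uniformly small, so a
  function taking the value e_a on a suitable dense part of D_a is
  Riemann integrable, but it is weakly discontinuous on every D_a. If the union
  of the D_a were null, a compact set B of measure at least 1/2 would miss it;
  by compactness, for each a the measure of B intersected with the first m
  constraints of D_a collapses at some stage m. By independence of the digits
  few marks cause a collapse after a given history, so, N_m being chosen large
  enough, A is covered by intervals of lengths less than eps.
*)

(** * Spaces with coordinates and tails of functionals *)

Lemma sum_delta (R : pzRingType) (K : choiceType) (A : {fset K}) (g : K -> R) i :
  \sum_(k <- A) g k * (i == k)%:R = if i \in A then g i else 0.
Proof.
case: ifPn => iA; last first.
  rewrite big_seq big1// => k kA.
  by have [ik|] := eqVneq i k; [rewrite ik kA in iA|rewrite mulr0].
rewrite (big_fsetD1 i)//= eqxx mulr1 big_seq big1 ?addr0// => k.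
by rewrite in_fsetD1 eq_sym => /andP[/negPf-> _]; rewrite mulr0.
Qed.

(** Common interface of c0(K) and lp(K), p > 1. [coord_upper] with q > 1 serves to make functionals
    small off a finite set, [coord_flat] to make the function in (2) Riemann integrable. Both fail
    for the l_1 space of an infinite set. *)
Record coordinates (R : realType) (K : choiceType) (q : R)
    (V : normedModType R) := Coordinates {
  coord : V -> K -> R;
  unit_vec : K -> V;
  coordD : forall x y k, coord (x + y) k = coord x k + coord y k;
  coordZ : forall a x k, coord (a *: x) k = a * coord x k;
  coord_unit : forall i k, coord (unit_vec i) k = (k == i)%:R;
  coord_norm : forall x k, `|coord x k| <= `|x|;
  coord_solid : forall x y,
    (forall k, `|coord x k| <= `|coord y k|) -> `|x| <= `|y|;
  coord_dense : forall x e, 0 < e -> exists A : {fset K},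
    `|x - \sum_(k <- A) coord x k *: unit_vec k| <= e;
  coord_upper : forall x y, (forall k, coord x k = 0 \/ coord y k = 0) ->
    `|x + y| `^ q <= `|x| `^ q + `|y| `^ q;
  coord_flat : forall e, 0 < e -> exists2 d, 0 < d &
    forall x, (forall k, `|coord x k| <= d) ->
      (forall A : {fset K}, \sum_(k <- A) `|coord x k| <= 1) -> `|x| <= e
}.

Section coordinates_theory.
Variables (R : realType) (K : choiceType) (q : R) (V : normedModType R).
Hypothesis q1 : 1 < q.
Variable C : coordinates K q V.
Local Notation ev := (coord C).
Local Notation un := (unit_vec C).

Lemma coordN x k : ev (- x) k = - ev x k.
Proof. by rewrite -scaleN1r coordZ mulN1r. Qed.

Lemma coordB x y k : ev (x - y) k = ev x k - ev y k.
Proof. by rewrite coordD coordN. Qed.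

Lemma coord0 k : ev 0 k = 0.
Proof. by rewrite -(subrr 0) coordB subrr. Qed.

Lemma coord_sum I (r : seq I) (F : I -> V) k :
  ev (\sum_(i <- r) F i) k = \sum_(i <- r) ev (F i) k.
Proof.
elim/big_rec2: _ => [|i x y _ <-]; [exact: coord0|exact: coordD].
Qed.

Definition coord_proj (A : {fset K}) x := \sum_(k <- A) ev x k *: un k.

Lemma coord_projE (A : {fset K}) x k :
  ev (coord_proj A x) k = if k \in A then ev x k else 0.
Proof.
rewrite coord_sum -sum_delta; apply: eq_bigr => i _.
by rewrite coordZ coord_unit.
Qed.

(* A gliding hump: otherwise n disjoint blocks of norm at most 1 give a vector
   of norm at most n^(1/q) at which phi is at least n e. *)
Lemma dual_tail (phi : {linear V -> R^o}) e : continuous phi -> 0 < e ->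
  exists A : {fset K}, forall x, (forall k, k \in A -> ev x k = 0) ->
    `|phi x| <= e * `|x|.
Proof.
move=> cphi e0; apply: contrapT => /forallNP tail.
have [c [c0 phic]] : exists c, 0 < c /\ forall x, `|phi x| <= c * `|x|.
  have /linear_boundedP[c [creal cP]] := (iffRL (linear_bounded_continuous phi)) cphi.
  exists (Num.max c 0 + 1); split.
    by rewrite ltr_pwDr// le_max lexx orbT.
  by move=> x; apply: cP; rewrite ltr_pwDr// le_max lexx.
have q0 : 0 < q by rewrite (lt_trans _ q1).
have blocks (n : nat) : exists x (A : {fset K}),
    [/\ forall k, k \notin A -> ev x k = 0, `|x| `^ q <= n%:R & n%:R * e <= phi x].
  elim: n => [|n [x [A [xA xn phix]]]].
    exists 0, fset0; split; first by move=> k _; rewrite coord0.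
      by rewrite normr0 powR0// gt_eqF.
    by rewrite mul0r linear0.
  have /existsNP[y0 /not_implyP[y0A /negP]] := tail A.
  rewrite -ltNge => y0e.
  have y00 : 0 < `|y0|.
    rewrite lt_def normr_ge0 andbT; apply: contraTneq y0e => y00.
    rewrite y00 mulr0 -leNgt; have /eqP := y00.
    by rewrite normr_eq0 => /eqP->; rewrite linear0 normr0.
  pose y := (Num.sg (phi y0) / `|y0|) *: y0.
  have sg1 : `|Num.sg (phi y0)| = 1.
    rewrite normr_sg; have [z|//] := eqVneq (phi y0) 0.
    by move: y0e; rewrite z normr0 ltNge mulr_ge0// ltW.
  have y1 : `|y| = 1.
    by rewrite normrZ normrM sg1 mul1r normfV normr_id mulVf// gt_eqF.
  have phiy : e < phi y.
    rewrite linearZ /= [X in _ < X](_ : _ = `|phi y0| / `|y0|); last first.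
      by rewrite [in RHS]normrEsg -mulrAC.
    by rewrite ltr_pdivlMr.
  have yA k : k \in A -> ev y k = 0 by move=> kA; rewrite coordZ y0A// mulr0.
  (* As |phi| <= c |.|, truncating y to finitely many coordinates with an error of at most [d] keeps
     the value of phi at least e. *)
  pose d := (phi y - e) / c.
  have d0 : 0 < d by rewrite divr_gt0// subr_gt0.
  have [B yB] := coord_dense C y d0.
  pose z := coord_proj B y.
  exists (x + z), (A `|` B)%fset; split.
  - move=> k; rewrite in_fsetU negb_or => /andP[kA kB].
    by rewrite coordD xA// coord_projE (negPf kB) addr0.
  - apply: (le_trans (coord_upper _)).
      move=> k; have [kA|kA] := boolP (k \in A); last by left; exact: xA.
      by right; rewrite coord_projE yA// if_same.
    rewrite -natr1 lerD//.
    have z1 : `|z| <= 1.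
      rewrite -y1; apply: (coord_solid (c := C)) => k; rewrite coord_projE.
      by case: ifP; rewrite ?normr0.
    have := @ge0_ler_powR _ q (ltW q0) `|z| 1; rewrite powR1 !nnegrE; exact.
  - rewrite linearD /= -natr1 mulrDl mul1r lerD//.
    have := phic (y - z); rewrite linearB /= => H.
    have {}H := le_trans (ler_norm _) H.
    have H2 : c * `|y - z| <= c * d by rewrite ler_pM2l.
    have cd : c * d = phi y - e by rewrite /d mulrC divfK// gt_eqF.
    lra.
have q10 : 0 < q - 1 by rewrite subr_gt0.
(* The blocks give (n e)^q <= (c |x|)^q <= c^q n, that is n^(q-1) <= (c/e)^q; n is chosen to violate
   this. *)
pose b := ((c / e) `^ q).
have b0 : 0 <= b by exact: powR_ge0.
pose n := (Num.truncn (b `^ (q - 1)^-1)).+1.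
have bn : b < n%:R `^ (q - 1).
  have -> : b = (b `^ (q - 1)^-1) `^ (q - 1).
    by rewrite -powRrM mulVf ?gt_eqF// powRr1.
  by apply: gt0_ltr_powR; rewrite ?nnegrE ?powR_ge0// truncnS_gt.
have [x [_ [_ xn phix]]] := blocks n.
have n0 : 0 < n%:R :> R by rewrite ltr0n.
have H : (n%:R * e) `^ q <= (c * `|x|) `^ q.
  apply: ge0_ler_powR; rewrite ?nnegrE ?mulr_ge0 ?(ltW e0) ?(ltW c0) ?(ltW q0)//.
  exact: le_trans phix (le_trans (ler_norm _) (phic x)).
have {}H : (n%:R * e) `^ q <= c `^ q * n%:R.
  apply: (le_trans H); rewrite powRM ?(ltW c0)//.
  by rewrite ler_wpM2l ?powR_ge0.
move: H; apply/negP; rewrite -ltNge.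
have -> : c `^ q = b * e `^ q.
  by rewrite /b -powRM ?(ltW e0) ?divr_ge0 ?(ltW c0) ?(ltW e0)// divfK// gt_eqF.
rewrite powRM ?(ltW e0) ?(ltW n0)// mulrAC ltr_pM2r ?powR_gt0//.
have -> : n%:R `^ q = n%:R `^ (q - 1) * n%:R :> R.
  rewrite -[X in _ * X]powRr1 ?ltW// -powRD ?subrK//.
  by apply/implyP => _; rewrite gt_eqF.
by rewrite ltr_pM2r.
Qed.

End coordinates_theory.

(** * The coordinate structure of c0(K) and lp(K) *)

Section c0_coordinates.
Variables (R : realType) (K : choiceType).

Let cv (x : c0 R K) (k : K) : R := x k.

Lemma c0_unit_subproof (i : K) :
  (fun k => (k == i)%:R : R^o) \in @c0_pred R K.
Proof.
apply/asboolP => e e0; apply: (@sub_finite_set _ _ [set i]) => // k /=.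
by have [->//|] := eqVneq k i; rewrite normr0 leNgt e0.
Qed.

Lemma c0_dense (x : c0 R K) e : 0 < e -> exists A : {fset K},
  `|x - \sum_(k <- A) cv x k *: C0 (c0_unit_subproof k)| <= e.
Proof.
move=> e0; have fin := valP x; move: fin => /asboolP/(_ e e0) fin.
exists (fset_set [set k | e <= `|x k|]).
apply: (@c0_norm_le R K) => [|k]; first exact: ltW e0.
set A := fset_set _.
have -> : (x - \sum_(k <- A) cv x k *: C0 (c0_unit_subproof k)) k =
    x k - \sum_(i <- A) x i * (k == i)%:R :> R.
  congr (_ - _); elim/big_rec2: _ => // i y1 y2 _ <-; exact: erefl.
rewrite sum_delta /A in_fset_set//; have [ke|ke] := leP e `|x k|.
  by rewrite mem_set// subrr normr0 ltW.
by rewrite memNset ?subr0 ?ltW//= leNgt ke.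
Qed.

(** For disjoint supports the norm of x + y is at most the larger of the two norms, so any positive
    exponent satisfies [coord_upper]; 2 is a choice. *)
Lemma c0_coordinates : coordinates K 2 (c0 R K).
Proof.
apply: (@Coordinates R K 2 (c0 R K) cv (fun i => C0 (c0_unit_subproof i))).
- by [].
- by [].
- by [].
- exact: c0_norm_ge.
- move=> x y xy; apply: c0_norm_le => [|k]; first exact: c0_norm_ge0.
  exact: le_trans (xy k) (c0_norm_ge y k).
- exact: c0_dense.
- move=> x y xy.
  have H : `|x + y| <= Num.max `|x| `|y|.
    apply: c0_norm_le => [|k]; first by rewrite le_max normr_ge0.
    rewrite [X in `|X|](_ : _ = cv x k + cv y k)// le_max.
    case: (xy k) => ->; rewrite ?add0r ?addr0.
      by apply/orP; right; exact: c0_norm_ge.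
    by apply/orP; left; exact: c0_norm_ge.
  rewrite !powR_mulrn// (@le_trans _ _ ((Num.max `|x| `|y|) ^+ 2))//.
    by rewrite lerXn2r ?nnegrE// le_max normr_ge0.
  by rewrite maxEle; case: ifP => _; rewrite ?lerDl ?lerDr sqr_ge0.
- move=> e e0; exists e => // x xe _; apply: c0_norm_le; first exact: ltW.
  exact: xe.
Qed.

End c0_coordinates.

Section lp_coordinates.
Variables (R : realType) (K : choiceType) (p : R).
Hypothesis p1 : 1 < p.

Let p0 : 0 < p. Proof. exact: lt_trans p1. Qed.
Local Notation L := (lp K (ltW p1)).
Let lv (x : L) (k : K) : R := x k.

Let lp_sum_ge0 (f : K -> R^o) : (0 <= lp_sum p f)%E.
Proof. by apply: esum_ge0 => k _; rewrite lee_fin powR_ge0. Qed.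

Lemma lp_sum_le (f : K -> R^o) c :
  (forall A : {fset K}, \sum_(k <- A) `|f k| `^ p <= c) -> (lp_sum p f <= c%:E)%E.
Proof.
move=> fc; apply: ge_ereal_sup => _ [X [finX _] <-].
by rewrite fsbig_finite// sumEFin lee_fin; exact: fc.
Qed.

Lemma lp_norm_powR (x : L) : `|x| `^ p = fine (lp_sum p x).
Proof.
by rewrite -powRrM mulVf ?gt_eqF// powRr1// fine_ge0.
Qed.

Lemma lp_norm_le (x : L) c :
  0 <= c -> (forall A : {fset K}, \sum_(k <- A) `|x k| `^ p <= c `^ p) ->
  `|x| <= c.
Proof.
move=> c0 /lp_sum_le xc.
have : `|x| `^ p <= c `^ p.
  rewrite lp_norm_powR -lee_fin fineK// ge0_fin_numE//.
  exact: le_lt_trans xc (ltry _).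
apply: contraTT; rewrite -!ltNge => cN.
by apply: gt0_ltr_powR => //; rewrite nnegrE.
Qed.

Lemma lp_fsum_le (x : L) (A : {fset K}) :
  \sum_(k <- A) `|x k| `^ p <= `|x| `^ p.
Proof.
rewrite lp_norm_powR -lee_fin fineK; last first.
  by rewrite ge0_fin_numE//; exact: (valP x).
apply: esum_ge; exists [set` A].
  by split => //; exact: finite_fset.
by rewrite fsbig_finite ?set_fsetK ?sumEFin//; exact: finite_fset.
Qed.

Lemma lp_unit_subproof (i : K) :
  (fun k => (k == i)%:R : R^o) \in @lp_pred_of R K p (ltW p1).
Proof.
rewrite unfold_in; apply: (@le_lt_trans _ _ 1%:E); last exact: ltry.
apply: lp_sum_le => A.
rewrite (eq_bigr (fun k => 1 * (i == k)%:R)) => [|k _]; last first.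
  rewrite eq_sym mul1r; case: eqP => _; first by rewrite normr1 powR1.
  by rewrite normr0 powR0// gt_eqF.
by rewrite sum_delta; case: ifP.
Qed.

Lemma lp_dense (x : L) e : 0 < e -> exists A : {fset K},
  `|x - \sum_(k <- A) lv x k *: Lp (lp_unit_subproof k)| <= e.
Proof.
move=> e0.
(* A finite set carrying all but less than e^p of the p-th power of the norm; without one, the norm
   of x would be strictly below itself. *)
have [A xA] : exists A : {fset K},
    `|x| `^ p - e `^ p < \sum_(k <- A) `|x k| `^ p.
  apply: contrapT => /forallNP H.
  have {}H (A : {fset K}) : \sum_(k <- A) `|x k| `^ p <= `|x| `^ p - e `^ p.
    by have /negP := H A; rewrite -leNgt.
  have d0 : 0 <= `|x| `^ p - e `^ p.
    by apply: le_trans (H fset0); rewrite big_seq_fset0.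
  have cp : ((`|x| `^ p - e `^ p) `^ p^-1) `^ p = `|x| `^ p - e `^ p.
    by rewrite -powRrM mulVf ?gt_eqF// powRr1.
  have : `|x| <= (`|x| `^ p - e `^ p) `^ p^-1.
    apply: lp_norm_le => [|A]; first exact: powR_ge0.
    by rewrite cp.
  move=> /(ge0_ler_powR (ltW p0) (normr_ge0 x) (powR_ge0 _ _)).
  by rewrite cp; have := powR_gt0 p e0; lra.
exists A; pose y : L := x - \sum_(k <- A) lv x k *: Lp (lp_unit_subproof k).
suff : `|y| <= e by [].
apply: lp_norm_le => [|B]; first exact: ltW e0.
have yE k : y k = if k \in A then 0 else x k.
  have -> : y k = x k - \sum_(i <- A) x i * (k == i)%:R :> R.
    congr (_ - _); elim/big_rec2: _ => // i y1 y2 _ <-; exact: erefl.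
  by rewrite sum_delta; case: ifP; rewrite ?subrr ?subr0.
(* What is left is the mass of x on B outside A; together with the mass on A it is at most the p-th
   power of the norm of x. *)
clearbody y; apply: (@le_trans _ _ (\sum_(k <- (B `\` A)%fset) `|x k| `^ p)).
  rewrite (bigID (fun k => k \in A)) /= big1 => [|k kA]; last first.
    by rewrite yE kA normr0 powR0// gt_eqF.
  rewrite add0r le_eqVlt; apply/orP; left; apply/eqP.
  rewrite -big_filter; rewrite [RHS](perm_big [seq k <- B | k \notin A]).
    rewrite !big_seq; apply: eq_bigr => k; rewrite mem_filter => /andP[kA _].
    by rewrite yE (negPf kA).
  apply: uniq_perm; rewrite ?filter_uniq ?fset_uniq// => k.
  by rewrite mem_filter in_fsetD.
have := lp_fsum_le x (A `|` B)%fset.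
rewrite (big_fsetID _ (fun k => k \in A)) /=.
set S1 := \sum_(_ <- _) _; set S2 := \sum_(_ <- _) _.
have -> : S1 = \sum_(k <- A) `|x k| `^ p.
  rewrite /S1; congr bigop; congr enum_fset; apply/fsetP => k; rewrite !inE/=.
  by case: (k \in A); rewrite /= ?andbF ?andbT ?orbT.
have -> : S2 = \sum_(k <- (B `\` A)%fset) `|x k| `^ p.
  rewrite /S2; congr bigop; congr enum_fset; apply/fsetP => k; rewrite !inE/=.
  by case: (k \in A); rewrite /= ?andbF ?andbT ?orbT.
lra.
Qed.

Lemma lp_coordinates : coordinates K p L.
Proof.
apply: (@Coordinates R K p L lv (fun i => Lp (lp_unit_subproof i))).
- by [].
- by [].
- by [].
- exact: lp_norm_ge.
- move=> x y xy; apply: lp_norm_le => // A.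
  apply: le_trans (lp_fsum_le y A); apply: ler_sum => k _.
  by apply: ge0_ler_powR (xy k); rewrite ?nnegrE// ltW.
- exact: lp_dense.
- move=> x y xy; pose s := `|x| `^ p + `|y| `^ p.
  have cp : (s `^ p^-1) `^ p = s.
    by rewrite -powRrM mulVf ?gt_eqF// powRr1// addr_ge0 ?powR_ge0.
  rewrite -/s -[leRHS]cp; apply: ge0_ler_powR; rewrite ?nnegrE ?powR_ge0// ?(ltW p0)//.
  apply: lp_norm_le => [|A]; first exact: powR_ge0.
  rewrite cp /s; apply: le_trans (lerD (lp_fsum_le x A) (lp_fsum_le y A)).
  rewrite -big_split /=; apply: ler_sum => k _.
  rewrite [X in `|X|](_ : _ = lv x k + lv y k)//.
  by case: (xy k) => ->; rewrite ?add0r ?addr0 ?lerDl ?lerDr powR_ge0.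
- move=> e e0; have p10 : 0 < p - 1 by rewrite subr_gt0.
  (* With d^(p-1) = e^p, the bound |x_k|^p <= d^(p-1) |x_k| sums to at most e^p. *)
  pose d := (e `^ p) `^ (p - 1)^-1.
  have dp : d `^ (p - 1) = e `^ p.
    by rewrite -powRrM mulVf ?gt_eqF// powRr1// powR_ge0.
  exists d; first by rewrite !powR_gt0.
  move=> x xd x1; apply: lp_norm_le => [|A]; first exact: ltW.
  rewrite -dp -[leRHS]mulr1.
  apply: le_trans (ler_wpM2l (powR_ge0 _ _) (x1 A)).
  rewrite mulr_sumr; apply: ler_sum => k _.
  have pw (u : R) : 0 <= u -> u `^ p = u `^ (p - 1) * u.
    move=> u0; rewrite -[X in _ * X]powRr1// -powRD ?subrK//.
    by rewrite gt_eqF.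
  by rewrite pw// ler_wpM2r// ge0_ler_powR ?nnegrE ?powR_ge0 ?(ltW p10)//; exact: xd.
Qed.

End lp_coordinates.

(** * Guessing sequences below cov(M) *)

(* Points x k of a product of finite sets, fewer than cov(M) many, are all met
   by a single g: otherwise the nowhere dense sets of those t whose digit
   sequence differs from x k everywhere cover [0,1]. *)
Lemma covM_guess (R : realType) (K : Type) (b : nat -> nat)
    (x : K -> nat -> nat) :
  card_lt [set: K] (covM R) -> (forall k m, (x k m < b m)%N) ->
  exists g : nat -> nat, forall k, exists m, g m = x k m.
Proof.
move=> /andP[_ /negP Kcov] xb.
(* The m-th digit is constant on cells of length 1 / [a m] and runs through all values below [b m]
   in each period of length 1/(m+1). *)
pose a m : R := (b m * m.+1)%:R.
pose dig (t : R) m := (Num.truncn (t * a m) %% b m)%N.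
pose N k := [set t | unit_itv R t /\ forall m, dig t m <> x k m].
have N01 k : N k `<=` unit_itv R by move=> t [].
apply: contrapT => /forallNP noguess; apply: Kcov.
apply: card_le_trans (@card_image_le _ _ N setT).
apply: (covMP R).2; split; last first.
  apply/seteqP; split=> [t [_ [k _ <-] []]//|t t01].
  have /existsNP[k kP] := noguess (dig t).
  by exists (N k); [exists k|split=> // m mk; apply: kP; exists m].
move=> _ [k _ <-]; split; first exact: N01.
apply/seteqP; split=> //.
suff H (y : R) : ~ @interior (subspace (unit_itv R))
    (@closure (subspace (unit_itv R)) (N k)) y by exact: H.
move=> yN; have yc := interior_subset yN.
have cl01 : @closure (subspace (unit_itv R)) (N k) `<=` unit_itv R.
  have c01 : @closed (subspace (unit_itv R)) (unit_itv R).
    by apply: closed_subspaceW; exact: interval_closed.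
  rewrite [X in _ `<=` X](iffLR (@closure_id (subspace (unit_itv R)) _) c01).
  exact: closure_subset.
have Iy := cl01 _ yc.
have {yN yc} : within (unit_itv R) (@nbhs R R y)
    (@closure (subspace (unit_itv R)) (N k)).
  rewrite (nbhs_subspace_in Iy). exact: yN.
move=> /nbhs_ballP[e /= e0 ye].
move: Iy; rewrite /unit_itv /= in_itv /= => /andP[y0 y1].
have [u [v [u0 uv v1 ue]]] : exists u v : R, [/\ 0 <= u, u < v, v <= 1 &
    forall s, u < s < v -> `|y - s| < e].
  pose d := Num.min e 1 / 2.
  have d0 : 0 < d by rewrite /d divr_gt0// lt_min e0 ltr01.
  have de : d < e.
    have le1 : Num.min e 1 <= e by rewrite ge_min lexx.
    by rewrite /d; lra.
  have d1 : d <= 2^-1.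
    have le1 : Num.min e 1 <= 1 by rewrite ge_min lexx orbT.
    by rewrite /d; lra.
  have [y2|y2] := leP y 2^-1.
    exists y, (y + d); split => //; [lra|lra|move=> s /andP[ys sd]].
    by rewrite ltr_norml; apply/andP; split; lra.
  exists (y - d), y; split => //; [lra|lra|move=> s /andP[ys sd]].
  by rewrite ltr_norml; apply/andP; split; lra.
(* As v - u > 2/(m+1), the period starting at q/(m+1), the first such point after u, lies inside ]u,
   v[. Its [c]-th cell has digit [x k m]; that open cell misses [N k], so its midpoint [s] is not in
   the closure. *)
pose m := Num.truncn (2 / (v - u)).
have m2 : 2 < (v - u) * m.+1%:R.
  by rewrite mulrC -ltr_pdivrMr ?subr_gt0// truncnS_gt.
have bm : (0 < b m)%N by exact: leq_ltn_trans (xb k m).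
have a0 : 0 < a m by rewrite ltr0n muln_gt0 bm.
pose q := (Num.truncn (u * m.+1%:R)).+1.
pose c := (b m * q + x k m)%N.
have qgt : u * m.+1%:R < q%:R by exact: truncnS_gt.
have qle : q%:R <= u * m.+1%:R + 1.
  by rewrite /q -natr1 lerD2r truncn_le mulr_ge0.
have aE : a m = (b m)%:R * m.+1%:R by rewrite /a natrM.
have b0 : 0 < (b m)%:R :> R by rewrite ltr0n.
have uc : u < c%:R / a m.
  rewrite ltr_pdivlMr// aE mulrCA (lt_le_trans (y := (b m)%:R * q%:R))//.
    by rewrite ltr_pM2l.
  by rewrite /c natrD natrM lerDl.
have q2 : q%:R + 1 < v * m.+1%:R :> R by move: m2; rewrite mulrBl; lra.
have cv : c.+1%:R / a m < v.
  rewrite ltr_pdivrMr// aE mulrCA (le_lt_trans (y := (b m)%:R * (q%:R + 1)))//.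
    by rewrite /c natr1 -natrM ler_nat mulnS addnC -addSn leq_add2r.
  by rewrite (ltr_pM2l b0).
pose s := (c%:R + 2^-1) / a m.
have cs : c%:R / a m < s by rewrite ltr_pM2r ?invr_gt0// ltrDl.
have sc : s < c.+1%:R / a m.
  by rewrite ltr_pM2r ?invr_gt0// -[ltRHS]natr1 ltrD2l invf_lt1// ltr1n.
have us := lt_trans uc cs; have sv := lt_trans sc cv.
have s01 : unit_itv R s.
  rewrite /unit_itv /= in_itv /= (ltW (le_lt_trans u0 us)) /=.
  exact: ltW (lt_le_trans sv v1).
have : @closure (subspace (unit_itv R)) (N k) s.
  apply: (ye s _ s01); rewrite /ball /=; by apply: ue; rewrite us sv.
have Js : @nbhs _ (subspace (unit_itv R)) s
    [set r : R | r \in `]c%:R / a m, (c.+1%:R / a m)[].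
  have : within (unit_itv R) (@nbhs R R s) [set r : R | r \in `]c%:R / a m, (c.+1%:R / a m)[].
    have := @near_in_itvoo R (c%:R / a m) (c.+1%:R / a m) s.
    rewrite in_itv /= cs sc => /(_ isT); apply: filterS => r rI _; exact: rI.
  by rewrite (@nbhs_subspace_in _ _ s s01).
move=> /(_ _ Js)[r [[_ /(_ m)]]] + rc; apply.
move: rc; rewrite /= in_itv /= ltr_pdivrMr// ltr_pdivlMr// => /andP[cr rc].
have rm : Num.truncn (r * a m) = c by apply: truncn_def; rewrite (ltW cr).
by rewrite /dig rm /c mulnC modnMDl modn_small.
Qed.

(** * Null sets and Riemann sums over equal partitions *)

Lemma lebesgue_measure_bigsetU_le (R : realType) (I : Type) (r : seq I)
    (F : I -> set (measurableTypeR R)) (c : R) :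
  (forall i, measurable (F i)) -> (forall i, (lebesgue_measure (F i) <= c%:E)%E) ->
  (lebesgue_measure (\big[setU/set0]_(i <- r) F i) <= ((size r)%:R * c)%:E)%E.
Proof.
move=> mF Fc; elim: r => [|i r IH]; first by rewrite big_nil measure0 mul0r.
rewrite big_cons /= -natr1 mulrDl mul1r addrC EFinD.
apply: le_trans (leeD (Fc i) IH); apply: measureU2 => //.
exact: bigsetU_measurable.
Qed.

(** The weights 2^-(m+1) sum to 1, so intersecting the covering unions for e = 1/(n+1) yields a
    measurable null superset. *)
Lemma negligible_small_covers (R : realType) (A : set R) :
  (forall e : R, 0 < e -> exists U : nat -> set R,
    [/\ forall m, measurable (U m : set (measurableTypeR R)),
        forall m, (lebesgue_measure (U m) <= (e / (2 ^ m.+1)%:R)%:E)%E &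
        A `<=` \bigcup_m U m]) ->
  (@lebesgue_measure R).-negligible A.
Proof.
move=> cov.
have /choice[U UP] (n : nat) : exists U : nat -> set R,
    [/\ forall m, measurable (U m : set (measurableTypeR R)),
        forall m, (lebesgue_measure (U m) <= (n.+1%:R^-1 / (2 ^ m.+1)%:R)%:E)%E &
        A `<=` \bigcup_m U m].
  by apply: cov; rewrite invr_gt0.
have mU n : @measurable _ (measurableTypeR R) (\bigcup_m U n m).
  by apply: bigcupT_measurable => m; have [] := UP n.
have mB : @measurable _ (measurableTypeR R) (\bigcap_n \bigcup_m U n m).
  exact: bigcapT_measurable.
exists (\bigcap_n \bigcup_m U n m); split => //; last first.
  by move=> t At n _; have [_ _] := UP n; exact.
apply/eqP; rewrite eq_le measure_ge0 andbT; apply/lee_addgt0Pr => e e0.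
rewrite add0e; pose n := Num.truncn (e^-1).
apply: (@le_trans _ _ (lebesgue_measure (\bigcup_m U n m))).
  by apply: le_measure; rewrite ?inE// => t; apply.
apply: (@le_trans _ _ (\sum_(m <oo) lebesgue_measure (U n m))%E).
  by apply: measure_sigma_subadditive => // m; have [] := UP n.
apply: (@le_trans _ _ (n.+1%:R^-1)%:E); last first.
  by rewrite lee_fin ltW// invf_plt ?posrE// truncnS_gt.
apply: le_trans (epsilon_trick0 xpredT _); last by rewrite invr_ge0.
by apply: lee_nneseries => // m _; have [] := UP n.
Qed.

Definition in_cell (R : realType) (N i : nat) (s : R) : bool :=
  i%:R / N%:R < s < i.+1%:R / N%:R.

Lemma in_cell_mid (R : realType) (N i : nat) : (0 < N)%N ->
  in_cell N i ((i%:R + 2^-1) / N%:R : R).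
Proof.
move=> N0; rewrite /in_cell !ltr_pM2r ?invr_gt0 ?ltr0n// ltrDl invr_gt0 ltr0n /=.
by rewrite -[ltRHS]natr1 ltrD2l invf_lt1// ltr1n.
Qed.

Section uniform_partitions.
Variables (R : realType) (N : nat) (s : nat -> R).
Hypothesis N0 : (0 < N)%N.
Hypothesis sP : forall i, (i < N)%N -> in_cell N i (s i).

Definition uniform_partition : tagged_partition R.
Proof.
apply: (@TaggedPartition R N (fun i => i%:R / N%:R) s) => //.
- by rewrite mul0r.
- by rewrite divff// pnatr_eq0 -lt0n.
Defined.

Lemma uniform_partition_norm d : N%:R^-1 < d -> tp_norm uniform_partition < d.
Proof.
move=> Nd; rewrite /tp_norm /=; elim/big_rec: _ => [|i x _ xd].
  by apply: lt_trans Nd; rewrite invr_gt0 ltr0n.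
by rewrite gt_max xd andbT -mulrBl -natr1 addrAC subrr add0r mul1r.
Qed.

End uniform_partitions.

(** Both taggings give sums within e/2 of the integral; comparing them eliminates the integral and
    leaves only oscillations. *)
Lemma riemann_uniform (R : realType) (X : normedModType R) (f : R -> X) e :
  riemann_integrable f -> 0 < e -> exists2 N, (0 < N)%N &
    forall s s' : nat -> R, (forall i, (i < N)%N -> in_cell N i (s i)) ->
      (forall i, (i < N)%N -> in_cell N i (s' i)) ->
      `|\sum_(i < N) N%:R^-1 *: (f (s i) - f (s' i))| < e.
Proof.
move=> [x fx] e0; have e2 : 0 < e / 2 by rewrite divr_gt0.
have [d d0 dP] := fx _ e2.
pose N := (Num.truncn d^-1).+1.
have Nd : N%:R^-1 < d by rewrite invf_plt ?posrE// truncnS_gt.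
exists N => // s s' sP s'P.
have E u (uP : forall i, (i < N)%N -> in_cell N i (u i)) :
    riemann_sum f (uniform_partition (ltn0Sn _) uP) =
    \sum_(i < N) N%:R^-1 *: f (u i).
  rewrite /riemann_sum /=; apply: eq_bigr => i _.
  by rewrite -mulrBl -natr1 addrAC subrr add0r mul1r.
have /dP := uniform_partition_norm (ltn0Sn _) sP Nd.
have /dP := uniform_partition_norm (ltn0Sn _) s'P Nd.
rewrite !E => H' H.
under eq_bigr do rewrite scalerBr.
rewrite sumrB; set a := \sum_(i < N) _ in H *; set b := \sum_(i < N) _ in H' *.
rewrite -(subrKA x) (le_lt_trans (ler_normD _ _))//.
by rewrite (distrC x); lra.
Qed.

(** Two taggings that differ only in the i-th cell leave a single term of the sum. *)
Lemma riemann_cell_bound (R : realType) (X : normedModType R) (f : R -> X) e N :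
  (0 < N)%N ->
  (forall s s' : nat -> R, (forall i, (i < N)%N -> in_cell N i (s i)) ->
      (forall i, (i < N)%N -> in_cell N i (s' i)) ->
      `|\sum_(i < N) N%:R^-1 *: (f (s i) - f (s' i))| < e) ->
  forall i (s t : R), (i < N)%N -> in_cell N i s -> in_cell N i t ->
    `|f s - f t| <= N%:R * e.
Proof.
move=> N0 H i s t iN si ti.
pose u r j : R := if j == i then r else (j%:R + 2^-1) / N%:R.
have uP r : in_cell N i r -> forall j, (j < N)%N -> in_cell N j (u r j).
  by move=> ri j jN; rewrite /u; case: eqP => [->//|_]; exact: in_cell_mid.
have := H _ _ (uP _ si) (uP _ ti).
rewrite (bigD1 (Ordinal iN))//= big1 => [|j jN]; last first.
  by rewrite /u (negPf jN : (nat_of_ord j == i) = false) subrr scaler0.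
rewrite /u eqxx addr0 normrZ gtr0_norm ?invr_gt0 ?ltr0n// mulrC.
by rewrite ltr_pdivrMr ?ltr0n// mulrC => /ltW.
Qed.

(** No absolute value is needed, as s and s' may be exchanged; the fixed sign prevents cancellation
    when the cells are summed. *)
Definition osc_cells (R : realType) (N : nat) (eta : R) (g : R -> R) : {set 'I_N} :=
  [set i : 'I_N | `[< exists s s', [/\ in_cell N i s, in_cell N i s' &
    eta < g s - g s'] >]].

(** Take tags that realise the oscillation in the cells of [osc_cells] and equal tags elsewhere: the
    k-th coordinate of the difference of the sums is at least the left-hand side. The same N serves
    every k. *)
Lemma card_osc_cells (R : realType) (K : choiceType) (q : R)
    (X : normedModType R) (C : coordinates K q X) (f : R -> X) e N eta k :
  (0 < N)%N -> 0 < eta ->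
  (forall s s' : nat -> R, (forall i, (i < N)%N -> in_cell N i (s i)) ->
      (forall i, (i < N)%N -> in_cell N i (s' i)) ->
      `|\sum_(i < N) N%:R^-1 *: (f (s i) - f (s' i))| < e) ->
  #|osc_cells N eta (fun t => coord C (f t) k)|%:R / N%:R * eta <= e.
Proof.
move=> N0 eta0 H; set g := fun t => _; set S := osc_cells _ _ _.
have /choice[u uP] (i : nat) : exists p : R * R,
    [/\ in_cell N i p.1, in_cell N i p.2 &
      (forall iN : (i < N)%N, if Ordinal iN \in S then is_true (eta <= g p.1 - g p.2)
       else p.1 = p.2)].
  pose c : R := (i%:R + 2^-1) / N%:R.
  have ic : in_cell N i c by exact: in_cell_mid.
  have [iN|iN] := pselect (i < N)%N; last first.
    by exists (c, c); split => // iN'; case: iN.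
  have [iS|iS] := boolP (Ordinal iN \in S); last first.
    by exists (c, c); split => // iN'; rewrite (bool_irrelevance iN' iN) (negPf iS).
  move: (iS); rewrite inE => /asboolP[s [s' [si s'i ss']]].
  exists (s, s'); split => // iN'; rewrite (bool_irrelevance iN' iN) iS.
  exact: ltW.
have := H (fun i => (u i).1) (fun i => (u i).2).
move=> /(_ (fun i _ => let: And3 a _ _ := uP i in a)).
move=> /(_ (fun i _ => let: And3 _ a _ := uP i in a)) /ltW; apply: le_trans.
apply: le_trans (coord_norm C _ k); apply: le_trans (ler_norm _).
rewrite coord_sum.
apply: (@le_trans _ _ (\sum_(i < N) if i \in S then N%:R^-1 * eta else 0)).
  by rewrite -big_mkcond sumr_const -mulrA -[leRHS]mulr_natl.
apply: ler_sum => i _; rewrite coordZ coordB.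
have [_ _ /(_ (ltn_ord i))] := uP i.
have -> : Ordinal (ltn_ord i) = i by exact: val_inj.
case: ifP => _ H'; last by rewrite H' subrr mulr0.
by rewrite ler_pM2l ?invr_gt0 ?ltr0n.
Qed.

(** * Weak continuity almost everywhere below cov(M) *)

Lemma weakly_continuous_from_coordinates (R : realType) (K : choiceType) (q : R)
    (V : normedModType R) (C : coordinates K q V) (f : R -> V) (M t : R) :
  1 < q -> unit_itv R t -> (\forall s \near t, `|f s - f t| <= M) ->
  (forall k, (fun s => coord C (f s) k) @ t --> coord C (f t) k) ->
  weakly_continuous_at f t.
Proof.
move=> q1 It fM fk; rewrite /weakly_continuous_at.
have near_sub (P : set R) : (\forall s \near t, P s) ->
    @nbhs _ (subspace (unit_itv R)) t P.
  move=> tP; have : within (unit_itv R) (nbhs t) P.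
    by apply: filterS tP => s Ps _.
  by rewrite (@nbhs_subspace_in _ _ t It).
apply/cvg_sup => -[phi cphi] A /= [_ [[B Bop <-] Bft sBA]].
apply: near_sub.
suff : \forall s \near t, B (phi (f s)) by apply: filterS => s Bs; exact: sBA.
suff : (fun s => phi (f s)) @ t --> phi (f t).
  by apply; exact: open_nbhs_nbhs.
apply/cvgrPdist_le => e e0.
have e2 : 0 < e / 2 by rewrite divr_gt0.
have M1 : 0 < `|M| + 1 by rewrite ltr_wpDl.
(* Off the finite set [E], phi contributes at most e/2 to any difference of norm at most M; on [E],
   coordinatewise convergence suffices. *)
have [E EP] := dual_tail q1 C cphi (divr_gt0 e2 M1).
pose h s := \sum_(k <- E) (coord C (f s) k - coord C (f t) k) * phi (unit_vec C k).
have h0 : h @ t --> (\sum_(k <- E) (0 : R)).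
  apply: cvg_big => [|k _]; first exact: add_continuous.
   have := cvgM (cvgB (fk k) (cvg_cst (coord C (f t) k)))
    (cvg_cst (phi (unit_vec C k) : R)).
  by rewrite subrr mul0r; apply; exact: nbhs_filter.
have {h0} : \forall s \near t, `|h s| <= e / 2.
  move/cvgrPdist_le : h0 => /(_ _ e2); apply: filterS => s.
  by rewrite big1// sub0r normrN.
move: fM; apply: filterS2 => s fM hs.
pose x := f s - f t; pose y := x - coord_proj C E x.
have yE : `|phi y| <= e / 2 / (`|M| + 1) * `|y|.
  by apply: EP => k kE; rewrite coordB coord_projE kE subrr.
have yx : `|y| <= `|x|.
  apply: (coord_solid (c := C)) => k; rewrite coordB coord_projE.
  by case: ifP; rewrite ?subrr ?subr0// normr0.
have px : phi (coord_proj C E x) = h s.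
  rewrite linear_sum /h; apply: eq_bigr => k _.
  by rewrite linearZ /= coordB.
have -> : phi (f t) - phi (f s) = - (phi y + h s).
  by rewrite -px -linearD subrK linearB opprB.
rewrite normrN (le_trans (ler_normD _ _))//.
have : `|phi y| <= e / 2; last by lra.
apply: (le_trans yE).
rewrite mulrAC ler_pdivrMr// ler_pM2l// (le_trans yx)// (le_trans fM)//.
by rewrite (le_trans (ler_norm _))// lerDl.
Qed.

Lemma itv01_in_cell (R : realType) (N : nat) (t : R) : (0 < N)%N -> 0 <= t <= 1 ->
  (forall i, t != i%:R / N%:R) -> exists2 i, (i < N)%N & in_cell N i t.
Proof.
move=> N0 /andP[t0 t1] tQ; have N0' : 0 < N%:R :> R by rewrite ltr0n.
have tN : 0 <= t * N%:R by rewrite mulr_ge0// ltW.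
exists (Num.truncn (t * N%:R)).
  rewrite truncn_lt_nat// -[ltRHS]mul1r ltr_pM2r// lt_neqAle t1 andbT.
  by have := tQ N; rewrite divff// gt_eqF.
rewrite /in_cell ltr_pdivlMr// truncnS_gt andbT ltr_pdivrMr// lt_neqAle.
rewrite truncn_le tN andbT; apply: contra (tQ (Num.truncn (t * N%:R))) => /eqP->.
by rewrite mulfK// gt_eqF.
Qed.

Lemma near_in_cell (R : realType) (N i : nat) (t : R) :
  in_cell N i t -> \forall s \near t, in_cell N i s.
Proof. by move=> /near_in_itvoo; apply: filterS => s; rewrite in_itv. Qed.

Lemma weak_lebesgue_of_lt_covM (R : realType) (K : choiceType) (q : R)
    (V : normedModType R) (f : R -> V) :
  1 < q -> coordinates K q V -> card_lt [set: K] (covM R) ->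
  riemann_integrable f ->
  (@lebesgue_measure R).-negligible
    [set t | unit_itv R t /\ ~ weakly_continuous_at f t].
Proof.
move=> q1 C Kcov fint.
(* [Q] is countable and contains all endpoints of cells of equal partitions; outside it, each t in
   [0,1] is interior to a cell. *)
pose Q : set R := (fun p : nat * nat => p.1%:R / p.2%:R) @` setT.
pose D n := [set t | [/\ unit_itv R t, ~ Q t & exists k,
  ~ \forall s \near t, `|coord C (f s) k - coord C (f t) k| <= n.+1%:R^-1]].
have nQ t : ~ Q t -> forall N i, t != i%:R / N%:R :> R.
  by move=> tQ N i; apply: contra_notN tQ => /eqP->; exists (i, N).
have sub : [set t | unit_itv R t /\ ~ weakly_continuous_at f t] `<=`
    Q `|` \bigcup_n D n.
  move=> t [It tw]; apply: contrapT => /not_orP[tQ tD]; apply: tw.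
  have [N N0 NP] := riemann_uniform fint ltr01.
  have [i iN ti] := itv01_in_cell N0 (It : 0 <= t <= 1) (nQ t tQ N).
  apply: (@weakly_continuous_from_coordinates _ _ _ _ C f N%:R) => //.
    move: (near_in_cell ti); apply: filterS => s si.
    by rewrite -[leRHS]mulr1; exact: (riemann_cell_bound N0 NP iN si ti).
  move=> k; apply/cvgrPdist_le => e e0.
  apply: contrapT => ne; apply: tD; exists (Num.truncn e^-1) => //.
  split=> //; exists k => tk; apply: ne; apply: filterS tk => s /le_trans.
  by rewrite distrC; apply; rewrite ltW// invf_plt ?posrE// truncnS_gt.
apply: (negligibleS (mu := @lebesgue_measure R) sub).
apply: (@negligibleU _ _ _ (@lebesgue_measure R)).
  have cQ : countable Q.
    by apply: card_le_trans (card_image_le _ _) _; exact: countableP.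
  exists Q; split => //; first exact: countable_measurable.
  exact: countable_lebesgue_measure0.
apply: negligible_bigcup => n; apply: negligible_small_covers => e e0.
pose eta : R := n.+1%:R^-1; have eta0 : 0 < eta by rewrite invr_gt0.
pose d m := e / (2 ^ m.+1)%:R; have d0 m : 0 < d m.
  by rewrite divr_gt0// ltr0n expn_gt0.
(* The tolerance [d m * eta] makes the cells oscillating by more than [eta] have total length at
   most [d m], by [card_osc_cells]. *)
have /choice[N NP] (m : nat) : exists N, (0 < N)%N /\
    forall s s' : nat -> R, (forall i, (i < N)%N -> in_cell N i (s i)) ->
      (forall i, (i < N)%N -> in_cell N i (s' i)) ->
      `|\sum_(i < N) N%:R^-1 *: (f (s i) - f (s' i))| < d m * eta.
  by have [M] := riemann_uniform fint (mulr_gt0 (d0 m) eta0); exists M.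
pose fk k t := coord C (f t) k.
(* Sets of cells are encoded by their rank among all subsets of ['I_(N m)], so that [covM_guess]
   applies; [S m] decodes the guess. *)
pose x k m : nat := enum_rank (osc_cells (N m) eta (fk k)).
have [g gx] := @covM_guess R K (fun m => #|{set 'I_(N m)}|) x Kcov
  (fun k m => ltn_ord _).
pose S m := nth finset.set0 (enum {set 'I_(N m)}) (g m).
pose cell m i : set R := `]i%:R / (N m)%:R, i.+1%:R / (N m)%:R[%classic.
(* A guess agreeing with no coordinate at m may list too many cells; it is then discarded, so that
   [U m] always has measure at most [d m]. *)
pose U m : set R := if #|S m|%:R / (N m)%:R <= d m then
  \big[setU/set0]_(i <- enum (S m)) cell m i else set0.
have mcell m i : measurable (cell m i : set (measurableTypeR R)).
  exact: measurable_itv.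
exists U; split.
- move=> m; rewrite /U; case: ifP => // _.
  by apply: bigsetU_measurable.
- move=> m; rewrite /U; case: ifP => [Sm|_]; last by rewrite measure0 lee_fin (ltW (d0 m)).
  apply: le_trans (@lebesgue_measure_bigsetU_le _ _ _ _ (N m)%:R^-1 _ _) _ => //.
    move=> i; rewrite /cell lebesgue_measure_itv /= lte_fin; case: ifP => _.
      by rewrite -EFinB -mulrBl -natr1 addrAC subrr add0r mul1r.
    by rewrite lee_fin invr_ge0.
  by rewrite lee_fin -cardE.
- move=> t [It tQ [k tk]]; have [m gm] := gx k.
  have [N0 NPm] := NP m.
  have [i iN ti] := itv01_in_cell N0 (It : 0 <= t <= 1) (nQ t tQ (N m)).
  have SE : S m = osc_cells (N m) eta (fk k).
    by rewrite /S gm /x nth_enum_rank.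
  exists m => //; rewrite /U SE ifT; last first.
    by rewrite -(ler_pM2r eta0); exact: card_osc_cells NPm.
  rewrite -bigcup_seq; exists (Ordinal iN); last by rewrite /cell /= in_itv.
  rewrite /= mem_enum inE; apply/asboolP; apply: contrapT => nosc; apply: tk.
  move: (near_in_cell ti); apply: filterS => s si.
  rewrite leNgt; apply/negP => st; apply: nosc.
  move: st; rewrite ltr_normr => /orP[st|st]; [exists s, t|exists t, s]; split=> //.
  by rewrite opprB in st.
Qed.

(** * Binary digits and dyadic intervals *)

Section binary_digits.
Variable R : realType.
Implicit Types t w : R.

Definition btrunc t n : nat := Num.truncn (t * 2 ^+ n).

(** For t >= 0 this is the coefficient of 2^-(n+1); dyadic points get the expansion ending in
    zeros. *)
Definition digit t n : bool := odd (btrunc t n.+1).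

Lemma btrunc_itv t n : 0 <= t ->
  (btrunc t n)%:R / 2 ^+ n <= t < (btrunc t n).+1%:R / 2 ^+ n.
Proof.
move=> t0; rewrite ler_pdivrMr ?ltr_pdivlMr ?exprn_gt0//.
by rewrite truncn_itv// mulr_ge0// exprn_ge0.
Qed.

Lemma btruncS t n : 0 <= t -> btrunc t n.+1 = ((btrunc t n).*2 + digit t n)%N.
Proof.
move=> t0; rewrite /digit -[LHS]odd_double_half addnC; congr (_.*2 + _)%N.
have /andP[] := btrunc_itv n t0; have /andP[] := btrunc_itv n.+1 t0.
set a := btrunc t n.+1; set b := btrunc t n.
rewrite exprS invfM !mulrA !ler_pdivrMr ?exprn_gt0// !ltr_pdivlMr ?exprn_gt0//.
set x := t * 2 ^+ n => ax xa bx xb.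
have ab : (a < (b.+1).*2)%N by rewrite -(ltr_nat R) -muln2 natrM; lra.
have ba : (b.*2 < a.+1)%N by rewrite -(ltr_nat R) -muln2 natrM; lra.
lia.
Qed.

Lemma btrunc0 t : 0 <= t < 1 -> btrunc t 0 = 0%N.
Proof. by move=> t01; apply: truncn_def; rewrite expr0 mulr1. Qed.

Lemma eq_btrunc t w n : 0 <= t < 1 -> 0 <= w < 1 ->
  (forall j, (j < n)%N -> digit t j = digit w j) -> btrunc t n = btrunc w n.
Proof.
move=> t01 w01; elim: n => [|n IH] tw; first by rewrite !btrunc0.
have [/andP[t0 _] /andP[w0 _]] := (t01, w01).
by rewrite !btruncS// IH ?tw// => j jn; rewrite tw// ltnW.
Qed.

Lemma btrunc_dist t w n : 0 <= t -> 0 <= w -> btrunc t n = btrunc w n ->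
  `|t - w| < (2 ^+ n)^-1.
Proof.
move=> t0 w0 tw; have := btrunc_itv n t0; have := btrunc_itv n w0.
rewrite tw -[(btrunc w n).+1%:R]natr1 mulrDl mul1r => /andP[? ?] /andP[? ?].
by rewrite ltr_norml; apply/andP; split; lra.
Qed.

(** The point is the supremum of the truncations [u n]. Infinitely many zero digits keep it strictly
    below every upper end [v n], so its truncations are the prescribed ones. *)
Lemma real_of_digits (b : nat -> bool) :
  (forall n, exists2 m, (n <= m)%N & ~~ b m) ->
  exists2 w, 0 <= w < 1 & forall n, digit w n = b n.
Proof.
move=> b0.
pose B := fix B n := if n is n'.+1 then ((B n').*2 + b n')%N else 0%N.
pose u n : R := (B n)%:R / 2 ^+ n; pose v n : R := (B n).+1%:R / 2 ^+ n.
have p2 n : 0 < 2 ^+ n :> R by rewrite exprn_gt0.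
have uS n : u n <= u n.+1.
  rewrite /u exprS invfM mulrA ler_pM2r ?invr_gt0// ler_pdivlMr//.
  by rewrite -natrM ler_nat muln2 /= leq_addr.
have vS n : v n.+1 <= v n.
  rewrite /v exprS invfM mulrA ler_pM2r ?invr_gt0// ler_pdivrMr//.
  rewrite -natrM ler_nat muln2 /= doubleS -addnS -addn2 leq_add2l.
  by case: (b n).
have uv n : u n < v n by rewrite ltr_pM2r ?invr_gt0// ltr_nat.
have u_le n m : (n <= m)%N -> u n <= u m.
  by move=> /subnK <-; elim: (m - n)%N => // d IH; exact: le_trans IH (uS _).
have v_ge n m : (n <= m)%N -> v m <= v n.
  by move=> /subnK <-; elim: (m - n)%N => // d IH; exact: le_trans (vS _) IH.
have u_v n m : u n <= v m.
  apply: le_trans (u_le _ _ (leq_maxl n m)) _.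
  exact: le_trans (ltW (uv _)) (v_ge _ _ (leq_maxr n m)).
pose w := sup (range u).
have uw n : u n <= w.
  by apply: ub_le_sup; [exists (v 0%N) => _ [m _ <-]; exact: u_v|exists n].
have wv n : w < v n.
  have [m nm bm] := b0 n.
  apply: lt_le_trans (v_ge _ _ nm); apply: (@le_lt_trans _ _ (v m.+1)).
    by apply: ge_sup; [exists (u 0%N), 0%N|move=> _ [k _ <-]; exact: u_v].
  rewrite /v exprS invfM mulrA ltr_pM2r ?invr_gt0// ltr_pdivrMr//.
  by rewrite -natrM ltr_nat muln2 /= (negPf bm) addn0 doubleS.
have w0 : 0 <= w by apply: le_trans (uw 0%N); rewrite /u mul0r.
have w1 : w < 1 by have := wv 0%N; rewrite /v expr0 divr1.
have wB n : btrunc w n = B n.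
  apply: truncn_def; rewrite -ler_pdivrMr// -ltr_pdivlMr//.
  by rewrite uw; exact: wv.
exists w; first by rewrite w0.
by move=> n; rewrite /digit wB /= oddD odd_double oddb.
Qed.

Lemma digit_dyadic i n j : (n <= j)%N -> digit (i%:R / 2 ^+ n) j = false.
Proof.
move=> nj; rewrite /digit /btrunc -(subnK (leqW nj)) exprD mulrCA divfK; last first.
  by rewrite expf_neq0// pnatr_eq0.
by rewrite -natrX -natrM natrK oddM oddX subn_eq0 ltnNge nj /= ?andbF.
Qed.

(** Left endpoints, in units of 2^-n, of the dyadic intervals of length 2^-n in [0,1[ whose points
    have digit b at all places of P before n. *)
Fixpoint cells (b : bool) (P : pred nat) n : seq nat :=
  if n is n'.+1 then
    if P n' then [seq (i.*2 + b)%N | i <- cells b P n']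
    else [seq i.*2 | i <- cells b P n'] ++ [seq i.*2.+1 | i <- cells b P n']
  else [:: 0%N].

Lemma size_cells b P n :
  (size (cells b P n) * 2 ^ count P (iota 0 n) = 2 ^ n)%N.
Proof.
elim: n => // n IH; rewrite -[in iota _ _]addn1 iotaD count_cat /= addn0 add0n.
case: ifP => Pn; rewrite ?size_cat !size_map.
  by rewrite expnD mulnA IH expnS mulnC.
by rewrite addn0 mulnDl IH addnn expnS mul2n.
Qed.

Lemma mem_cells b (P : pred nat) t n : 0 <= t < 1 ->
  (forall j, (j < n)%N -> P j -> digit t j = b) -> btrunc t n \in cells b P n.
Proof.
move=> t01; have /andP[t0 _] := t01; elim: n => [|n IH] tP.
  by rewrite btrunc0// inE.
have {}IH : btrunc t n \in cells b P n by apply: IH => j jn; apply: tP; rewrite ltnW.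
rewrite btruncS//=; case: ifPn => Pn.
  by rewrite tP//; apply/mapP; exists (btrunc t n).
rewrite mem_cat; apply/orP; case: (digit t n).
  by right; apply/mapP; exists (btrunc t n); rewrite ?addn1.
by left; apply/mapP; exists (btrunc t n); rewrite ?addn0.
Qed.

Lemma size_cells_le b (P : pred nat) M n : (M <= count P (iota 0 n))%N ->
  (size (cells b P n))%:R <= 2 ^+ n / 2 ^+ M :> R.
Proof.
move=> MP; rewrite ler_pdivlMr ?exprn_gt0// -!natrX -natrM ler_nat.
by rewrite -(size_cells b P n) leq_mul2l leq_exp2l// MP orbT.
Qed.

(** At least M prescribed digits leave at most 2^(n-M) dyadic intervals of length 2^-n. *)
Lemma measure_digits b (P : pred nat) M n (A : set (measurableTypeR R)) :
  measurable A -> (M <= count P (iota 0 n))%N ->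
  (forall t, A t -> 0 <= t < 1 /\ forall j, (j < n)%N -> P j -> digit t j = b) ->
  (lebesgue_measure A <= ((2 ^+ M)^-1)%:E)%E.
Proof.
move=> mA MP AP.
pose F i : set (measurableTypeR R) := `[i%:R / 2 ^+ n, i.+1%:R / 2 ^+ n[%classic.
have mF i : measurable (F i) by exact: measurable_itv.
have p2 k : 0 < 2 ^+ k :> R by rewrite exprn_gt0.
apply: (@le_trans _ _ (lebesgue_measure (\big[setU/set0]_(i <- cells b P n) F i))).
  apply: le_measure; rewrite ?inE//; first exact: bigsetU_measurable.
  move=> t /AP[t01 tP]; rewrite -bigcup_seq; exists (btrunc t n).
    exact: mem_cells.
  by rewrite /F /= in_itv /= btrunc_itv//; case/andP: t01.
apply: le_trans (@lebesgue_measure_bigsetU_le R _ _ F (2 ^+ n)^-1 _ _) _ => //.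
  move=> i; rewrite /F lebesgue_measure_itv /= lte_fin; case: ifP => _.
    by rewrite -EFinB -mulrBl -[i.+1%:R]natr1 addrAC subrr add0r mul1r.
  by rewrite lee_fin invr_ge0 exprn_ge0.
rewrite lee_fin ler_pdivrMr//; apply: le_trans (size_cells_le b MP) _.
by rewrite mulrC.
Qed.

Lemma measurable_digit j :
  measurable ([set t | 0 <= t < 1 /\ ~~ digit t j] : set (measurableTypeR R)).
Proof.
rewrite (_ : [set _ | _] = \bigcup_(i in [set i | (i < 2 ^ j.+1)%N && ~~ odd i])
    `[i%:R / 2 ^+ j.+1, i.+1%:R / 2 ^+ j.+1[%classic).
  by apply: bigcup_measurable => i _; exact: measurable_itv.
have p2 k : 0 < 2 ^+ k :> R by rewrite exprn_gt0.
apply/seteqP; split=> [t [/andP[t0 t1] tj]|t [i /= /andP[ij oi]]].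
  exists (btrunc t j.+1); last by rewrite /= in_itv /= btrunc_itv.
  rewrite /= tj andbT truncn_lt_nat ?mulr_ge0 ?(ltW (p2 _))//.
  by rewrite natrX -[ltRHS]mul1r ltr_pM2r.
rewrite in_itv /= => /andP[it ti].
have t0 : 0 <= t by apply: le_trans it; rewrite divr_ge0 ?(ltW (p2 _)).
have t1 : t < 1.
  apply: lt_le_trans ti _; rewrite ler_pdivrMr// mul1r -natrX ler_nat//.
split; first by rewrite t0.
rewrite /digit (_ : btrunc _ _ = i)//; apply: truncn_def.
by rewrite -ler_pdivrMr// -ltr_pdivlMr// it.
Qed.

End binary_digits.

(** * Tags of a partition in intervals and in digit sets *)

Lemma tp_node_mono (R : realType) (P : tagged_partition R) i :
  (i < tp_size P)%N -> tp_node P i < tp_node P i.+1.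
Proof. by move=> /tp_tag_in/andP[]; exact: lt_trans. Qed.

Lemma tp_norm_ge0 (R : realType) (P : tagged_partition R) : 0 <= tp_norm P.
Proof.
by rewrite /tp_norm; elim/big_rec: _ => // i x _; rewrite le_max orbC => ->.
Qed.

Lemma tp_norm_ge (R : realType) (P : tagged_partition R) i :
  (i < tp_size P)%N -> tp_node P i.+1 - tp_node P i <= tp_norm P.
Proof.
move=> iP; rewrite /tp_norm (bigD1 (Ordinal iP))//= le_max lexx//.
Qed.

Lemma tp_sum_lengths (R : realType) (P : tagged_partition R) :
  \sum_(i < tp_size P) (tp_node P i.+1 - tp_node P i) = 1.
Proof.
rewrite -(big_mkord xpredT (fun i => tp_node P i.+1 - tp_node P i)) telescope_sumr//.
by rewrite tp_node0 tp_node_size subr0.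
Qed.

(** A partition interval with its tag in [u, v[ lies in [u - d, v + d], where [clip] is the
    identity. Clipping is monotone, so all clipped lengths are nonnegative and they telescope. *)
Lemma tp_tags_in_itv (R : realType) (P : tagged_partition R) (d u v : R) :
  tp_norm P <= d -> u <= v ->
  \sum_(i < tp_size P) (if u <= tp_tag P i < v then
    tp_node P i.+1 - tp_node P i else 0) <= v - u + d *+ 2.
Proof.
move=> Pd uv.
have d0 : 0 <= d := le_trans (tp_norm_ge0 P) Pd.
pose clip x := Num.max (u - d) (Num.min x (v + d)).
have clip_mono x y : x <= y -> clip x <= clip y.
  by move=> xy; rewrite /clip ge_max !le_max lexx /= le_min !ge_min xy lexx !orbT.
apply: (@le_trans _ _ (\sum_(i < tp_size P)
    (clip (tp_node P i.+1) - clip (tp_node P i)))).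
  apply: ler_sum => i _; have iP := ltn_ord i.
  have := tp_norm_ge iP; have /andP[it ti] := tp_tag_in iP.
  move=> iN; case: ifPn => [/andP[ut tv]|_]; last first.
    by rewrite subr_ge0 clip_mono// ltW// tp_node_mono.
  have clipE x : u - d <= x <= v + d -> clip x = x.
    by move=> /andP[ux xv]; rewrite /clip (min_idPl xv) (max_idPr ux).
  by rewrite !clipE//; apply/andP; split; lra.
rewrite -(big_mkord xpredT (fun i => clip (tp_node P i.+1) - clip (tp_node P i))).
rewrite telescope_sumr//.
have : clip (tp_node P (tp_size P)) <= v + d.
  by rewrite /clip ge_max ge_min lexx orbT andbT; lra.
have : u - d <= clip (tp_node P 0) by rewrite /clip le_max lexx.
by rewrite mulr2n; lra.
Qed.

(** The counterpart of [measure_digits] for Riemann sums: [tp_tags_in_itv] summed over [cells]. The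
    bound tends to 2^-M as d tends to 0. *)
Lemma tp_tags_in_digits (R : realType) (Q : tagged_partition R) (d : R) b
    (P : pred nat) M n (S : set R) :
  tp_norm Q <= d -> (M <= count P (iota 0 n))%N ->
  (forall t, S t -> 0 <= t < 1 /\ forall j, (j < n)%N -> P j -> digit t j = b) ->
  \sum_(i < tp_size Q) (if `[< S (tp_tag Q i) >] then
     tp_node Q i.+1 - tp_node Q i else 0) <=
  2 ^+ n / 2 ^+ M * ((2 ^+ n)^-1 + d *+ 2).
Proof.
move=> Qd MP SP.
have p2 k : 0 < 2 ^+ k :> R by rewrite exprn_gt0.
have d0 : 0 <= d := le_trans (tp_norm_ge0 Q) Qd.
apply: (@le_trans _ _ (\sum_(i < tp_size Q) \sum_(c <- cells b P n)
    if c%:R / 2 ^+ n <= tp_tag Q i < c.+1%:R / 2 ^+ n then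
     tp_node Q i.+1 - tp_node Q i else 0)).
  apply: ler_sum => i _.
  have l0 : 0 <= tp_node Q i.+1 - tp_node Q i by rewrite subr_ge0 ltW// tp_node_mono.
  have F0 c : 0 <= (if c%:R / 2 ^+ n <= tp_tag Q i < c.+1%:R / 2 ^+ n then
     tp_node Q i.+1 - tp_node Q i else 0) by case: ifP.
  case: asboolP => [/SP[t01 tP]|_]; last exact: sumr_ge0.
  have /(perm_big _)-> := perm_to_rem (mem_cells t01 tP).
  rewrite big_cons btrunc_itv; last by case/andP: t01.
  by rewrite lerDl; exact: sumr_ge0.
rewrite exchange_big /=.
apply: (@le_trans _ _ (\sum_(c <- cells b P n) ((2 ^+ n)^-1 + d *+ 2))).
  apply: ler_sum => c _; apply: le_trans (tp_tags_in_itv Qd _) _.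
    by rewrite ler_pM2r ?invr_gt0// ler_nat.
  by rewrite lerD2r -mulrBl -[c.+1%:R]natr1 addrAC subrr add0r mul1r.
rewrite big_const_seq count_predT iter_addr_0 -[leLHS]mulr_natl.
rewrite ler_wpM2r ?addr_ge0 ?invr_ge0 ?mulrn_wge0 ?(ltW (p2 _))//.
exact: size_cells_le.
Qed.

(** * The sets D_a and the function built on them *)

Section coded_sets.
Variables (R : realType) (T : Type) (A : set T).
Variables (off : nat -> nat) (pos : T -> nat -> nat).
Hypothesis offS : forall m, ((off m).+2 <= off m.+1)%N.
Hypothesis posP : forall a m, A a -> (off m <= pos a m < off m.+1)%N.
Hypothesis pos_inj : forall a b, A a -> A b ->
  (exists n, forall m, (n <= m)%N -> pos a m = pos b m) -> a = b.

(** The m-th block consists of the digits from [off m] up to but excluding [off m.+1], and a marks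
    its digit [pos a m]. Blocks have at least two digits, so each also contains an unmarked one. *)
Definition marked a : pred nat := fun j => `[< exists m, pos a m = j >].

(* The final digits of a point of [coded a] spell out the marks of a, which
   makes the sets [coded a] disjoint. *)
Definition coded a : set R := [set t | [/\ 0 <= t < 1,
  forall j, marked a j -> ~~ digit t j &
  exists n, forall j, (n <= j)%N -> ~~ marked a j -> digit t j]].

Lemma off_mono m n : (m <= n)%N -> (off m <= off n)%N.
Proof.
move=> /subnK <-; elim: (n - m)%N => // d IH.
exact: leq_trans IH (leq_trans (leqnSn _) (leq_trans (leqnSn _) (offS _))).
Qed.

Lemma off_ge m : (m <= off m)%N.
Proof. by elim: m => // m IH; have := offS m; lia. Qed.

Lemma pos_block a b m n : A a -> A b -> pos a m = pos b n -> m = n.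
Proof.
move=> Aa Ab mn; have /andP[] := posP m Aa; have /andP[] := posP n Ab.
rewrite mn => n1 n2 m1 m2; apply/eqP; rewrite eqn_leq.
have [|mn'] := ltnP m n; first by move=> /off_mono; lia.
by rewrite andbT; case: ltngtP mn' => // /off_mono; lia.
Qed.

Lemma count_marked a m : A a -> (m <= count (marked a) (iota 0 (off m)))%N.
Proof.
move=> Aa; rewrite -size_filter -[X in (X <= _)%N](size_iota 0 m).
rewrite -(size_map (pos a)); apply: uniq_leq_size.
  rewrite map_inj_in_uniq ?iota_uniq// => i j _ _; exact: (pos_block Aa Aa).
move=> j /mapP[i]; rewrite mem_iota add0n => /= im ->.
rewrite mem_filter mem_iota add0n /=; apply/andP; split.
  by apply/asboolP; exists i.
by have /andP[_ /leq_trans->] := posP i Aa => //; exact: off_mono.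
Qed.

(** Far enough out, a digit marked by a is 0 in t, hence marked by b as well. Both marks are in the
    same block, so they coincide from some block on. *)
Lemma coded_disjoint a b t : A a -> A b -> coded a t -> coded b t -> a = b.
Proof.
move=> Aa Ab [_ at0 _] [_ _ [n tn]]; apply: pos_inj => //; exists n => m nm.
have ma : marked a (pos a m) by apply/asboolP; exists m.
have nj : (n <= pos a m)%N.
  by have /andP[+ _] := posP m Aa; apply: leq_trans; exact: leq_trans (off_ge m).
have : marked b (pos a m).
  by apply: contraT => /(tn _ nj); rewrite (negPf (at0 _ ma)).
move=> /asboolP[m' mm']; by rewrite -mm' (pos_block Ab Aa mm').
Qed.

(** Keep the first n digits of t and continue with 0 exactly at the marked places; these are
    infinitely many, as [real_of_digits] requires. *)
Lemma coded_approx a n t : A a -> 0 <= t < 1 ->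
  (forall j, (j < n)%N -> marked a j -> ~~ digit t j) ->
  exists2 w, coded a w & `|w - t| < (2 ^+ n)^-1.
Proof.
move=> Aa t01 tn.
have [|w w01 wd] := @real_of_digits R
  (fun j => if (j < n)%N then digit t j else ~~ marked a j).
  move=> m; exists (pos a (m + n)).
    by have /andP[+ _] := posP (m + n) Aa; have := off_ge (m + n); lia.
  rewrite ifF ?negbK; first by apply/asboolP; exists (m + n)%N.
  by have /andP[+ _] := posP (m + n) Aa; have := off_ge (m + n); lia.
exists w.
  split => // [j mj|]; rewrite ?wd; first by case: ifP => [/tn->|]//; rewrite mj.
  by exists n => j nj mj; rewrite wd ltnNge nj.
have [/andP[t0 _] /andP[w0 _]] := (t01, w01).
by apply: btrunc_dist => //; apply: eq_btrunc => // j jn; rewrite wd jn.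
Qed.

(** The digits of a dyadic point end in zeros, whereas in a point of [coded a] the unmarked digits
    of all late blocks are 1. *)
Lemma coded_not_dyadic a i n : A a -> ~ coded a (i%:R / 2 ^+ n).
Proof.
move=> Aa [_ _ [n' nd]]; pose m := (n + n')%N.
have [j jP nj] : exists2 j, (off m <= j < off m.+1)%N & j <> pos a m.
  have [->|ne] := eqVneq (pos a m) (off m).
    by exists (off m).+1; [have := offS m; lia|lia].
  by exists (off m); [have := offS m; lia|move/esym/eqP; exact/negP].
have mj : ~~ marked a j.
  apply/negP => /asboolP[m' mm']; apply: nj; rewrite -mm'; congr pos.
  have /andP[] := posP m' Aa; rewrite mm' => j1 j2.
  apply/eqP; rewrite eqn_leq; apply/andP; split.
    by rewrite leqNgt; apply/negP => /off_mono; lia.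
  by rewrite leqNgt; apply/negP => /off_mono; lia.
have mo : (n + n' <= off m)%N := off_ge m.
have n'j : (n' <= j)%N by lia.
by have := nd j n'j mj; rewrite digit_dyadic//; lia.
Qed.

Variables (K : choiceType) (q : R) (V : normedModType R) (C : coordinates K q V).
Variable iota_ : T -> K.
Hypothesis iota_inj : forall a b, A a -> A b -> iota_ a = iota_ b -> a = b.

Definition coded_fun (t : R) : V :=
  match pselect (exists2 a, A a & coded a t) with
  | left H => unit_vec C (iota_ (projT1 (cid2 H)))
  | right _ => 0
  end.

Lemma coded_funE t a : A a -> coord C (coded_fun t) (iota_ a) = `[< coded a t >]%:R.
Proof.
move=> Aa; rewrite /coded_fun; case: pselect => [H|H].
  case: (cid2 H) => b /= Ab tb; rewrite coord_unit; congr (_%:R).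
  case: asboolP => ta; first by rewrite (coded_disjoint Aa Ab ta tb) eqxx.
  by case: eqP => // /(iota_inj Aa Ab) ab; case: ta; rewrite ab.
rewrite coord0; case: asboolP => // ta; case: H; by exists a.
Qed.

Lemma coded_fun_out t k : (forall a, A a -> iota_ a <> k) ->
  coord C (coded_fun t) k = 0.
Proof.
move=> nk; rewrite /coded_fun; case: pselect => [H|H]; last exact: coord0.
case: (cid2 H) => b /= Ab tb; rewrite coord_unit.
by case: eqP => // kb; case: (nk b Ab).
Qed.

Lemma coded_fun_sum t (B : {fset K}) : \sum_(k <- B) `|coord C (coded_fun t) k| <= 1.
Proof.
rewrite /coded_fun; case: pselect => [H|H]; last first.
  by rewrite big1// => k _; rewrite coord0 normr0.
rewrite (eq_bigr (fun k => 1 * (iota_ (projT1 (cid2 H)) == k)%:R)).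
  by rewrite sum_delta; case: ifP.
by move=> k _; rewrite coord_unit eq_sym normr_nat mul1r.
Qed.

(** The coordinate of a Riemann sum at [iota_ a] is the total length of the intervals tagged in
    [coded a]. It is small uniformly in a, since the first M marks lie before [off M] for every a.
    The coordinates sum to at most 1, so [coord_flat] applies. *)
Lemma coded_fun_riemann : riemann_integrable coded_fun.
Proof.
exists 0 => e e0; have e2 : 0 < e / 2 by rewrite divr_gt0.
have [w w0 flat] := coord_flat C e2.
have p2 k : 0 < 2 ^+ k :> R by rewrite exprn_gt0.
pose M := Num.truncn (2 / w).
have Mw : (2 ^+ M)^-1 <= w / 2.
  rewrite -[w / 2]invrK invf_div lef_pV2 ?posrE ?divr_gt0//.
  apply: le_trans (ltW (truncnS_gt _)) _; rewrite -natrX ler_nat -/M.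
  exact: ltn_expl.
(* Chosen so that the bound of [tp_tags_in_digits] becomes 2^-M + w/2, which is at most w. *)
pose d := w / 4 * (2 ^+ M / 2 ^+ off M).
have d0 : 0 < d by rewrite mulr_gt0 ?divr_gt0.
exists d => // P Pd; rewrite subr0.
suff : `|riemann_sum coded_fun P| <= e / 2 by lra.
have l0 (i : 'I_(tp_size P)) : 0 <= tp_node P i.+1 - tp_node P i.
  by rewrite subr_ge0 ltW// tp_node_mono.
have cE k : coord C (riemann_sum coded_fun P) k =
    \sum_(i < tp_size P) (tp_node P i.+1 - tp_node P i) *
      coord C (coded_fun (tp_tag P i)) k.
  by rewrite coord_sum; apply: eq_bigr => i _; rewrite coordZ.
apply: flat => [k|B]; last first.
  apply: (@le_trans _ _ (\sum_(k <- B) \sum_(i < tp_size P)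
      (tp_node P i.+1 - tp_node P i) * `|coord C (coded_fun (tp_tag P i)) k|)).
    apply: ler_sum => k _; rewrite cE (le_trans (ler_norm_sum _ _ _))//.
    by apply: ler_sum => i _; rewrite normrM (ger0_norm (l0 i)).
  rewrite exchange_big -[leRHS](tp_sum_lengths P) /=; apply: ler_sum => i _.
  by rewrite -mulr_sumr -[leRHS]mulr1 ler_wpM2l// coded_fun_sum.
rewrite cE; have [[a Aa <-]|nk] := pselect (exists2 a, A a & iota_ a = k); last first.
  rewrite big1 ?normr0 ?ltW// => i _; rewrite coded_fun_out ?mulr0// => a Aa ak.
  by apply: nk; exists a.
rewrite ger0_norm; last first.
  by apply: sumr_ge0 => i _; rewrite mulr_ge0// coded_funE.
have aP t : coded a t -> 0 <= t < 1 /\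
    forall j, (j < off M)%N -> marked a j -> digit t j = false.
  by move=> [t01 ta _]; split => // j _ /ta/negPf.
have := tp_tags_in_digits (ltW Pd) (count_marked M Aa) aP.
rewrite (eq_bigr (fun i : 'I__ => (tp_node P i.+1 - tp_node P i) *
      coord C (coded_fun (tp_tag P i)) (iota_ a))) => [|i _]; last first.
  by rewrite coded_funE//; case: asboolP => _; rewrite ?mulr1 ?mulr0.
move=> /le_trans; apply.
have -> : 2 ^+ off M / 2 ^+ M * ((2 ^+ off M)^-1 + d *+ 2) = (2 ^+ M)^-1 + w / 2.
  by rewrite /d -mulr_natl; field; rewrite !gt_eqF.
lra.
Qed.

(** Arbitrarily close to t the coordinate at [iota_ a] takes the value 1, on [coded a], and the
    value 0, at dyadic truncations of t. Hence it is discontinuous at t whatever its value there. *)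
Lemma coded_fun_discontinuous a t : A a -> unit_itv R t ->
  (forall e, 0 < e -> exists2 w, coded a w & `|w - t| < e) ->
  ~ weakly_continuous_at coded_fun t.
Proof.
move=> Aa t01 tw fc.
have cc : continuous (fun x => coord C x (iota_ a) : R^o).
  move=> x; apply/cvgrPdist_lt => e e0.
  have : \forall y \near x, `|x - y| < e.
    by apply/nbhs_ballP; exists e => //= y; rewrite -ball_normE.
  by apply: filterS => y xy; rewrite -coordB (le_lt_trans (coord_norm _ _ _)).
have cl : linear (fun x => coord C x (iota_ a) : R^o).
  by move=> l x y; rewrite coordD coordZ.
pose lin := GRing.isLinear.Build R V R^o *:%R _ cl.
pose phi : {linear V -> R^o} := HB.pack (fun x => coord C x (iota_ a) : R^o) lin.
have := fc; rewrite /weakly_continuous_at /prop_for /continuous_at => /cvg_sup.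
move=> /(_ (exist _ phi cc)) /(_ (phi @^-1` ball (phi (coded_fun t)) 2^-1)).
have : nbhs (coded_fun t : initial_topology phi)
    (phi @^-1` ball (phi (coded_fun t)) 2^-1).
  by apply: initial_continuous; apply: nbhsx_ballx; rewrite invr_gt0.
move=> ft /(_ ft) tt.
have {tt} : @nbhs_subspace R (unit_itv R) t
  (fun r => ball (phi (coded_fun t)) 2^-1 (phi (coded_fun r))) := tt.
rewrite -(@nbhs_subspace_in _ _ t t01) => /nbhs_ballP[e /= e0 te].
have fclose r : `|r - t| < e -> 0 <= r <= 1 ->
    `| `[< coded a t >]%:R - `[< coded a r >]%:R | < 2^-1 :> R.
  move=> rt r01; rewrite -!coded_funE//; apply: te => //.
  by rewrite /ball /= distrC.
have [w wa wt] := tw _ e0.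
have := fclose _ wt; have [/andP[w0 w1] _ _] := wa.
rewrite w0 (ltW w1) => /(_ isT); rewrite (asboolT wa).
have /andP[t0 t1] : 0 <= t <= 1 by exact: t01.
pose n := Num.truncn e^-1; pose r : R := (btrunc t n)%:R / 2 ^+ n.
have p2 k : 0 < 2 ^+ k :> R by rewrite exprn_gt0.
have /andP[rt tr] := btrunc_itv n t0.
have := fclose r.
rewrite (asboolF (@coded_not_dyadic a (btrunc t n) n Aa)) subr0.
have -> : `|r - t| < e.
  rewrite distrC ger0_norm ?subr_ge0//; apply: (@lt_le_trans _ _ ((2 ^+ n)^-1)).
    by move: tr; rewrite -[(btrunc t n).+1%:R]natr1 mulrDl mul1r -/r; lra.
  rewrite invf_ple ?posrE//; apply: le_trans (ltW (truncnS_gt _)) _.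
  by rewrite -natrX ler_nat ltn_expl.
have -> : 0 <= r <= 1.
  by rewrite (le_trans (rt : r <= t) t1) andbT divr_ge0 ?(ltW (p2 _)).
move=> /(_ isT isT); case: asboolP => _; rewrite ?subrr ?normr0 ?normr1 ?sub0r ?normrN1.
  by move=> + _; rewrite ltNge invf_le1// ler1n.
by move=> _; rewrite ltNge invf_le1// ler1n.
Qed.

End coded_sets.

(** * Strong nullness from the collapse of measures *)

Lemma strongly_null_slices (R : realType) (A : set R) :
  (forall z : int, strongly_null (A `&` [set a | z%:~R <= a < z%:~R + 1])) ->
  strongly_null A.
Proof.
move=> AZ e e0.
(* The indices are split among the slices by coding pairs (z, i); slice z uses only the lengths at
   codes of the form (z, i). *)
have /choice[I IP] (z : int) := AZ z (fun n => e (choice.pickle (z, n))) (fun n => e0 _).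
pose J n := if choice.unpickle n is Some (z, i) then
  (if choice.pickle (z : int, i : nat) == n then I z i else `]0, 0[) else `]0, 0[.
have empty n : (lebesgue_measure ([set` `]0%R, 0%R[] : set R) < (e n)%:E)%E.
  by rewrite set_itvE measure0 lte_fin.
exists J; split=> [n|a Aa].
  rewrite /J; case: choice.unpickle => [[z i]|]; last exact: empty.
  by case: eqP => [<-|_]; [exact: (IP z).1|exact: empty].
pose z := Num.floor a.
have [|n _ an] := (IP z).2 a; first by split=> //=; rewrite -intrD1 floor_itv.
by exists (choice.pickle (z, n)) => //=; rewrite /J choice.pickleK eqxx.
Qed.

Section digit_sets.
Variable R : realType.

Definition zeros (S : seq nat) : set (measurableTypeR R) :=
  [set t : R | 0 <= t < 1 /\ all (fun j => ~~ digit t j) S].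

Lemma measurable_zeros S : measurable (zeros S).
Proof.
elim: S => [|j S IH].
  rewrite (_ : zeros _ = `[0%R, 1%R[%classic); first exact: measurable_itv.
  by apply/seteqP; split=> t /=; rewrite in_itv /=; [case|split].
rewrite (_ : zeros _ = [set t | 0 <= t < 1 /\ ~~ digit t j] `&` zeros S).
  by apply: measurableI => //; exact: measurable_digit.
apply/seteqP; split=> t; first by case=> t01 /andP[].
by case=> -[t01 tj] [_ tS]; split => //; rewrite /= tj.
Qed.

(* The digits in r are independent: if each of them is nonzero on most of B
   then nearly all of B has all its digits in r equal to 1. *)
Lemma measure_lt_of_zeros (B : set (measurableTypeR R)) (r : seq nat) e :
  measurable B -> (forall t, B t -> 0 <= t < 1) -> uniq r -> size r = e.+1 ->
  (forall j, j \in r ->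
    (lebesgue_measure (B `&` zeros [:: j]) < ((2 ^+ (2 * e).+2)^-1)%:E)%E) ->
  (lebesgue_measure B < ((2 ^+ e)^-1)%:E)%E.
Proof.
move=> mB B01 ur sr Br.
have p2 k : 0 < 2 ^+ k :> R by rewrite exprn_gt0.
pose F j : set (measurableTypeR R) := if j \in r then B `&` zeros [:: j] else set0.
have mF j : measurable (F j).
  rewrite /F; case: ifP => // _; apply: measurableI => //; exact: measurable_zeros.
pose U := \big[setU/set0]_(j <- r) F j.
have mU : measurable U by exact: bigsetU_measurable.
pose c : R := (2 ^+ (2 * e).+2)^-1.
have Uc : (lebesgue_measure U <= (e.+1%:R * c)%:E)%E.
  rewrite -sr; apply: lebesgue_measure_bigsetU_le => // j.
  rewrite /F; case: ifP => jr; first exact: ltW (Br _ jr).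
  by rewrite measure0 lee_fin invr_ge0 ltW.
have Vc : (lebesgue_measure (B `\` U) <= ((2 ^+ e.+1)^-1)%:E)%E.
  apply: (@measure_digits R true (mem r) e.+1 (\max_(j <- r) j).+1).
  - exact: measurableD.
  - rewrite -sr -size_filter; apply: uniq_leq_size => // j jr.
    rewrite mem_filter mem_iota /= jr /= add0n ltnS.
    by rewrite (perm_big _ (perm_to_rem jr)) big_cons leq_maxl.
  - move=> t [Bt nU]; split=> [|j _ jr]; first exact: B01.
    apply/negPn/negP => tj; apply: nU; rewrite /U -bigcup_seq; exists j => //.
    by rewrite /F (jr : j \in r); split => //; split; rewrite /= ?tj// B01.
have -> : B = (U `|` (B `\` U)).
  apply/seteqP; split=> [t Bt|t [|[]]//].
    by have [Ut|Ut] := pselect (U t); [left|right].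
  rewrite /U -bigcup_seq => -[j /= jr]; rewrite /F (jr : j \in r); by case.
apply: le_lt_trans (measureU2 _ _ _) _ => //; first exact: measurableD.
apply: le_lt_trans (leeD Uc Vc) _; rewrite -EFinD lte_fin.
have -> : (2 ^+ e)^-1 = (2 ^+ e.+1)^-1 + (2 ^+ e.+1)^-1 :> R.
  by rewrite exprS; field; rewrite gt_eqF.
rewrite ltrD2r /c.
have -> : 2 ^+ (2 * e).+2 = 2 ^+ e.+1 * 2 ^+ e.+1 :> R.
  by rewrite -exprD; congr (_ ^+ _); lia.
rewrite invfM mulrA ltr_pdivrMr// mulVf ?gt_eqF//.
by rewrite ltr_pdivrMr// mul1r -natrX ltr_nat ltn_expl.
Qed.

End digit_sets.

Lemma finite_reciprocal_bound (R : realType) (T : finType) (e : T -> R) n :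
  (forall x, 0 < e x) -> exists N, (n < N)%N /\ forall x, N%:R^-1 < e x.
Proof.
move=> e0; exists (n + \max_x (Num.truncn (e x)^-1)).+1; split => [|x].
  by rewrite ltnS leq_addr.
rewrite invf_plt ?posrE ?ltr0n//; apply: lt_le_trans (truncnS_gt _) _.
rewrite ler_nat ltnS; apply: leq_trans (leq_addl _ _).
exact: (@leq_bigmax _ (fun x => Num.truncn (e x)^-1)).
Qed.

(* The thresholds 2^-e are chosen so that (e + 1) 2^-(2e + 2) + 2^-(e + 1) < 2^-e,
   as needed in measure_lt_of_zeros. *)
Fixpoint tower_exp m := if m is m'.+1 then (2 * tower_exp m').+2 else 1%N.

Lemma weak_lebesgue_slice_null (R : realType) (K : choiceType) (q : R)
    (V : normedModType R) (C : coordinates K q V) (A : set R) (z : R)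
    (iota_ : R -> K) :
  (forall f : R -> V, riemann_integrable f ->
    (@lebesgue_measure R).-negligible
      [set t | unit_itv R t /\ ~ weakly_continuous_at f t]) ->
  (forall a, A a -> z <= a < z + 1) ->
  (forall a b, A a -> A b -> iota_ a = iota_ b -> a = b) ->
  strongly_null A.
Proof.
move=> wlp Az iota_inj eps eps0.
have p2 k : 0 < 2 ^+ k :> R by rewrite exprn_gt0.
(* Once the block start o is known, only finitely many histories S and ranks l can occur at stage m.
   So one number of pieces makes 1/N smaller than all the lengths reserved for them; N > m + 1 makes
   the pieces separate points. *)
have /choice[Nf NfP] (m : nat) : exists Nf : nat -> nat, forall o,
    (m.+1 < Nf o)%N /\ forall (S : m.-tuple 'I_o) (l : 'I_(tower_exp m).+1),
      (Nf o)%:R^-1 < eps (choice.pickle (m, map val S, val l)).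
  have /choice[Nf NfP] (o : nat) := @finite_reciprocal_bound R
    (m.-tuple 'I_o * 'I_(tower_exp m).+1)%type
    (fun x => eps (choice.pickle (m, map val x.1, val x.2))) m.+1 (fun=> eps0 _).
  exists Nf => o; have [N1 NP] := NfP o; split => // S l; exact: (NP (S, l)).
pose off := fix off m := if m is m'.+1 then (off m' + Nf m' (off m'))%N else 0%N.
pose N m := Nf m (off m).
have N_ge m : (m.+1 < N m)%N by have [] := NfP m (off m).
have N1 m : (1 < N m)%N by apply: leq_ltn_trans (N_ge m).
have N0 m : 0 < (N m)%:R :> R by rewrite ltr0n ltnW.
pose x a m := Num.truncn ((a - z) * (N m)%:R).
pose pos a m := (off m + x a m)%N.
have xN a m : A a -> (x a m < N m)%N.
  move=> /Az/andP[za az]; rewrite truncn_lt_nat ?mulr_ge0 ?subr_ge0 ?(ltW (N0 _))//.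
  by rewrite -[ltRHS]mul1r ltr_pM2r//; lra.
have x_itv a m : A a -> (x a m)%:R <= (a - z) * (N m)%:R < (x a m).+1%:R.
  by move=> /Az/andP[za az]; rewrite truncn_itv// mulr_ge0 ?subr_ge0 ?(ltW (N0 _)).
have offS m : ((off m).+2 <= off m.+1)%N.
  by rewrite -addn2 /= leq_add2l; exact: N1.
have posP a m : A a -> (off m <= pos a m < off m.+1)%N.
  by move=> Aa; rewrite leq_addr ltn_add2l; exact: xN.
have pos_inj a b : A a -> A b ->
    (exists n, forall m, (n <= m)%N -> pos a m = pos b m) -> a = b.
  move=> Aa Ab [n nP]; apply/eqP/negPn/negP => ab.
  have d0 : 0 < `|a - b| by rewrite normr_gt0 subr_eq0.
  pose m := maxn n (Num.truncn `|a - b|^-1).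
  have /addnI xab := nP m (leq_maxl _ _).
  have := x_itv a m Aa; have := x_itv b m Ab; rewrite xab -[(x b m).+1%:R]natr1.
  move=> /andP[b1 b2] /andP[a1 a2].
  have : `|(a - b) * (N m)%:R| < 1 by rewrite ltr_norml; apply/andP; split; lra.
  apply/negP; rewrite -leNgt normrM (gtr0_norm (N0 _)) mulrC -ler_pdivrMr// mul1r.
  apply: le_trans (ltW (truncnS_gt _)) _; rewrite ler_nat.
  exact: leq_ltn_trans (leq_maxr n _) (ltnW (N_ge m)).
pose f := @coded_fun R R A pos K q V C iota_.
have fint : riemann_integrable f by exact: coded_fun_riemann.
have [W [mW W0 badW]] := wlp _ fint.
have [U [oU WU UW]] : exists U : set R, [/\ open U, W `<=` U &
    (lebesgue_measure U < (2^-1)%:E)%E].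
  have [||U [oU WU UW]] := @lebesgue_regularity_outer R W 2^-1 mW.
  - exact: (eq_ind_r (fun v => v < +oo)%E (ltry 0) W0).
  - by rewrite invr_gt0.
  exists U; split => //; have mU := open_measurable oU.
  have UE : U = W `|` (U `\` W) by rewrite setDUK.
  rewrite UE; apply: le_lt_trans (measureU2 _ _ _) _ => //; first exact: measurableD.
  by rewrite [X in (X + _)%E]W0 add0e.
pose B := unit_itv R `\` U.
have cB : compact B.
  apply: compact_closedI; first exact: segment_compact.
  exact: open_closedC.
have mB : measurable (B : set (measurableTypeR R)).
  by apply: measurableD; [exact: measurable_itv|exact: open_measurable].
pose mu S := lebesgue_measure (B `&` @zeros R S).
have mBz S : measurable (B `&` @zeros R S).
  by apply: measurableI => //; exact: measurable_zeros.
pose eta m : R := (2 ^+ tower_exp m)^-1.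
pose pre a m := [seq pos a i | i <- iota 0 m].
(* [eta 0] is 1/2, and [U] has measure below 1/2. *)
have mu0 : ((eta 0%N)%:E <= mu [::])%E.
  rewrite leNgt; apply/negP => mu0.
  pose I : set (measurableTypeR R) := `[0%R, 1%R[%classic.
  have mI : measurable I by exact: measurable_itv.
  have mU : measurable (U : set (measurableTypeR R)) := open_measurable oU.
  have : (lebesgue_measure I < 1)%E.
    apply: (@le_lt_trans _ _ (mu [::] + lebesgue_measure U)%E).
      apply: le_trans (@measureU2 _ _ _ (@lebesgue_measure R) _ _ (mBz [::]) mU).
      have mBU := measurableU _ _ (mBz [::]) mU.
      apply: le_measure; [exact: mem_set|exact: mem_set|].
      move=> t; rewrite /I /= in_itv /= => t01; have /andP[t0 t1] := t01.
      have [Ut|nUt] := pselect (U t); [by right|left; split=> //; split=> //].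
      by rewrite /unit_itv /= in_itv /= t0 ltW.
    have -> : 1%E = ((2^-1)%:E + (2^-1)%:E)%E :> \bar R.
      by rewrite -EFinD -[2^-1]mul1r -splitr.
    exact: lteD mu0 UW.
  by rewrite lebesgue_measure_itv /= lte_fin ltr01 sube0 ltxx.
(* Without a collapse, every finite set of constraints from a is met in the compact set [B]. A
   cluster point of such solutions is a limit of points of [coded a], so f is weakly discontinuous
   there, although [B] avoids the discontinuities. *)
have drop_mu a : A a -> exists m, ((eta m)%:E <= mu (pre a m))%E /\
    (mu (pos a m :: pre a m) < (eta m.+1)%:E)%E.
  move=> Aa; apply: contrapT => /forallNP nm.
  have big m : ((eta m)%:E <= mu (pre a m))%E.
    elim: m => [|m IH]; first exact: mu0.
    have -> : mu (pre a m.+1) = mu (pos a m :: pre a m).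
      congr (lebesgue_measure (B `&` _)); apply/seteqP; rewrite /zeros /pre.
      rewrite -[in iota _ m.+1]addn1 iotaD map_cat /= add0n.
      split=> t [t01]; first by rewrite all_cat /= andbT andbC => tS; split.
      by move=> /= /andP[tp tS]; split=> //; rewrite all_cat tS /= tp.
    by rewrite leNgt; apply/negP => lt; apply: (nm m).
  have /choice[u uP] (n : nat) : exists t, (B `&` @zeros R (pre a n)) t.
    apply/set0P/eqP => B0; have := big n.
    by rewrite /mu B0 measure0 lee_fin leNgt invr_gt0 p2.
  have [t [Bt tu]] : B `&` cluster (u @ \oo) !=set0.
    apply: cB; exists 0%N => // n _; exact: (uP n).1.
  have [It nUt] := Bt.
  have ft : weakly_continuous_at f t.
    by apply: contrapT => nft; apply/nUt/WU/badW.
  apply: (coded_fun_discontinuous offS posP pos_inj iota_inj Aa It _ ft).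
  move=> e e0; pose M := Num.truncn (2 / e).
  have Me : (2 ^+ M)^-1 < e / 2.
    rewrite -[e / 2]invrK invf_div ltf_pV2 ?posrE ?divr_gt0//.
    apply: lt_le_trans (truncnS_gt _) _; rewrite -natrX ler_nat -/M.
    exact: ltn_expl.
  have [_ [[n /= Mn <-] un]] : [set u n | n in [set n | (M <= n)%N]] `&`
      ball t (e / 2) !=set0.
    apply: tu; last by apply: nbhsx_ballx; rewrite divr_gt0.
    by exists M => // n Mn; exists n.
  have [Bu [u01 uz]] := uP n.
  (* The marks before [off n] are those of the first n blocks, where [u n] has zeros. *)
  have [|w wa wu] := coded_approx offS posP Aa u01 (n := off n).
    move=> j jn /asboolP[m mj]; apply: (allP uz); apply/mapP; exists m => //.
    rewrite mem_iota add0n /=; rewrite ltnNge; apply/negP => mn.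
    have := off_mono offS mn; have /andP[+ _] := posP a m Aa; rewrite mj; lia.
  exists w => //; rewrite -(subrKA (u n)) (le_lt_trans (ler_normD _ _))//.
  move: un; rewrite /ball /= distrC => un.
  have : (2 ^+ off n)^-1 <= (2 ^+ M)^-1 :> R; last by lra.
  rewrite lef_pV2 ?posrE// ler_eXn2l ?ltr1n//.
  exact: leq_trans Mn (off_ge offS n).
(* The marks in block m that cause a collapse after the history S. If there were more than
   [tower_exp m] of them, [measure_lt_of_zeros] would put the measure for S below [eta m]. *)
pose bad m S := [seq c <- iota 0 (N m) | (mu (off m + c :: S)%N < (eta m.+1)%:E)%E].
have bad_size m S : ((eta m)%:E <= mu S)%E -> (size (bad m S) < (tower_exp m).+1)%N.
  rewrite ltnNge leNgt; apply: contra => large.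
  pose r := [seq (off m + c)%N | c <- take (tower_exp m).+1 (bad m S)].
  apply: (@measure_lt_of_zeros R _ r) => //.
  - exact: mBz.
  - by move=> t [_ []].
  - rewrite map_inj_uniq => [|i j /addnI//].
    by rewrite take_uniq// filter_uniq// iota_uniq.
  - by rewrite size_map size_take_min; apply/minn_idPl.
  - move=> j /mapP[c /mem_take]; rewrite mem_filter => /andP[cS _] ->.
    have -> : B `&` @zeros R S `&` @zeros R [:: (off m + c)%N] =
        B `&` @zeros R ((off m + c)%N :: S).
      apply/seteqP; split=> t.
        by move=> [[Bt [t01 tS]] [_ /= /andP[tc _]]]; split=> //; split; rewrite //= tc.
      by move=> [Bt [t01 /= /andP[tc tS]]]; do 2!split=> //; rewrite /= tc.
    exact: cS.
(* The interval with code (m, r, l) is the piece of the l-th bad mark after the history r. The test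
   on [eps n] bounds the length also at codes of impossible histories. *)
pose J n := if choice.unpickle n is Some (m, r, l) then
  (if (N m)%:R^-1 < eps n then let c := nth 0%N (bad m r) l in
     `[z + c%:R / (N m)%:R, z + c.+1%:R / (N m)%:R[ else `]0, 0[) else `]0, 0[.
exists J; split=> [n|a Aa].
  have empty : (lebesgue_measure ([set` `]0%R, 0%R[] : set R) < (eps n)%:E)%E.
    by rewrite set_itvE measure0 lte_fin.
  rewrite /J; case: choice.unpickle => [[[m r] l]|] //; case: ifP => // Nn.
  rewrite lebesgue_measure_itv /=; case: ifP => _; last by rewrite lte_fin.
  rewrite -EFinB lte_fin opprD addrACA subrr add0r -mulrBl -natr1 addrAC subrr.
  by rewrite add0r mul1r.
have [m [m1 m2]] := drop_mu a Aa.
have xb : x a m \in bad m (pre a m) by rewrite mem_filter m2 mem_iota xN.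
pose l := index (x a m) (bad m (pre a m)).
have lm : (l < (tower_exp m).+1)%N.
  by apply: ltn_trans (bad_size _ _ m1); rewrite index_mem.
exists (choice.pickle (m, pre a m, l)) => //=.
rewrite /J choice.pickleK ifT; last first.
  have pm (i : 'I_m) : (pos a i < off m)%N.
    have /andP[_ /leq_trans->] := posP a i Aa => //.
    by apply: off_mono.
  have -> : pre a m = map val [tuple Ordinal (pm i) | i < m].
    by rewrite /pre -val_enum_ord -!map_comp; exact: eq_map.
  by have [_ /(_ _ (Ordinal lm))] := NfP m (off m).
rewrite /= nth_index// in_itv /=; have /andP[x1 x2] := x_itv a m Aa.
by rewrite -lerBrDl -ltrBlDl ler_pdivrMr// ltr_pdivlMr// x1.
Qed.

(** * Failure of the property from non(SN) on, and both halves for c0(K) and lp(K) *)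

Lemma not_weak_lebesgue_of_nonSN_le (R : realType) (K : choiceType) (q : R)
    (V : normedModType R) :
  coordinates K q V -> (nonSN R #<= [set: K])%card ->
  ~ (forall f : R -> V, riemann_integrable f ->
    (@lebesgue_measure R).-negligible
      [set t | unit_itv R t /\ ~ weakly_continuous_at f t]).
Proof.
move=> C + wlp => /card_leP[g]; have nSN := (nonSNP R).1.
(* The empty set is strongly null; [a0] supplies a default for extending the injection to all of
   R. *)
have [a0 Aa0] : nonSN R !=set0.
  apply/set0P/eqP => A0; apply: nSN; rewrite A0 => e e0.
  exists (fun=> `]0, 0[); split=> // n.
  by rewrite set_itvE measure0 lte_fin.
pose j a (Aa : nonSN R a) : nonSN R := exist _ a (mem_set Aa).
pose i a := if pselect (nonSN R a) is left Aa then set_val (g (j a Aa))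
  else set_val (g (j a0 Aa0)).
have iE a (Aa : nonSN R a) : i a = set_val (g (j a Aa)).
  rewrite /i; case: pselect => // Aa'; congr (set_val (g (j a _))).
  exact: Prop_irrelevance.
apply: nSN; apply: strongly_null_slices => z.
apply: (@weak_lebesgue_slice_null R K q V C _ z%:~R i wlp); first by move=> a [].
move=> a b [Aa _] [Ab _]; rewrite !iE => /val_inj ab.
by have /(congr1 val) := 'inj_g (mem_set I) (mem_set I) ab.
Qed.

Theorem theorem2p8 (R : realType) (K : choiceType) :
  (card_lt [set: K] (covM R) ->
     weak_lebesgue_property (c0 R K) /\
     forall (p : R) (hp : 1 < p), weak_lebesgue_property (lp K (ltW hp))) /\
  ((nonSN R #<= [set: K])%card ->
     ~ weak_lebesgue_property (c0 R K) /\
     forall (p : R) (hp : 1 < p), ~ weak_lebesgue_property (lp K (ltW hp))).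
Proof.
split=> [Kcov|Ksn]; split.
- move=> f; apply: (weak_lebesgue_of_lt_covM _ (c0_coordinates R K) Kcov).
  by rewrite ltr1n.
- by move=> p hp f; exact: (weak_lebesgue_of_lt_covM hp (lp_coordinates K hp) Kcov).
- exact: (not_weak_lebesgue_of_nonSN_le (c0_coordinates R K) Ksn).
- by move=> p hp; exact: (not_weak_lebesgue_of_nonSN_le (lp_coordinates K hp) Ksn).
Qed.
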